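(* Let $(R, \mathfrak{m})$ be an equidimensional Noetherian local ring of dimension $d$ that is a homomorphic image of a Cohen-Macaulay local ring. Let $x_1, \ldots, x_d$ be a system of parameters of $R$. Then for all $s < d$ and all $n \ge 1$: \begin{enumerate} \item[(1)] $(x_1, \ldots, x_s)^n : x_{s+1} \subseteq \overline{(x_1, \ldots, x_s)^n} : x_{s+1} = \overline{(x_1, \ldots, x_s)^n}$, where $\overline{I}$ denotes the integral closure of an ideal $I$. \item[(2)] If $R$ contains a field of prime characteristic $p > 0$, then $$(x_1, \ldots, x_s)^n : x_{s+1} \subseteq \big((x_1, \ldots, x_s)^n\big)^{*} : x_{s+1} = \big((x_1, \ldots, x_s)^n\big)^{*},$$ where $I^{*}$ denotes the tight closure of an ideal $I$. \end{enumerate}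
   Context: For $s = 0$ the ideal $(x_1,\ldots,x_s)$ is $(0)$. In prime characteristic $p$, an element $x \in R$ lies in the tight closure $I^{*}$ of an ideal $I$ if there is some $c \in R$ with $c \notin P$ for all minimal primes $P$ of $R$ such that $c x^{p^e} \in I^{[p^e]}$ for all $e \gg 0$, where $I^{[p^e]} = (a^{p^e} \mid a \in I)$ is the $e$-th Frobenius power of $I$. Equidimensional means $\dim R/P = \dim R$ for every minimal prime $P$ of $R$. *)

(* Defs.v *)
From HB Require Import structures.
From mathcomp Require Import all_boot all_algebra ring_quotient.
From mathcomp Require Import boolp classical_sets.

Set Implicit Arguments.
Unset Strict Implicit.
Unset Printing Implicit Defensive.

Import GRing.Theory.
Local Open Scope classical_set_scope.
Local Open Scope ring_scope.

(* MathComp's [idealr R] and [prime_idealr R] bundle proper ideals and prime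
   ideals as boolean predicates, which is no restriction in the presence of the
   classical axioms of [boolp].  Ideals that may be the unit ideal (colons,
   closures, powers) are represented below as [set R]. *)

Section Ideals.
Variable R : comNzRingType.
Implicit Types (I J : set R) (x a c : R) (s : seq R).

Definition is_ideal I : Prop :=
  [/\ I 0, forall a b, I a -> I b -> I (a + b) & forall a b, I b -> I (a * b)].

Definition ideal_span (A : set R) : set R := smallest is_ideal A.

Definition ideal_of s : set R := ideal_span [set` s].

Definition ideal_mul I J : set R := ideal_span [set a * b | a in I & b in J].

Definition ideal_pow I (n : nat) : set R := iter n (ideal_mul I) [set: R].

Definition colon I x : set R := [set a | I (a * x)].

Definition radical I : set R := [set a | exists k, I (a ^+ k)].

Definition integral_closure I : set R :=
  [set z | exists (k : nat) (a : nat -> R),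
     [/\ (0 < k)%N, forall i, (1 <= i <= k)%N -> ideal_pow I i (a i)
       & z ^+ k + \sum_(1 <= i < k.+1) a i * z ^+ (k - i) = 0]].

Definition noetherian : Prop :=
  forall I, is_ideal I -> exists s, I = ideal_of s.

Definition maximal_ideal (m : idealr R) : Prop :=
  forall J : idealr R, [set` m] `<=` [set` J] -> [set` J] = [set` m].

Definition local_ring (m : idealr R) : Prop :=
  maximal_ideal m /\
  forall J : idealr R, maximal_ideal J -> [set` J] = [set` m].

Definition minimal_prime (P : prime_idealr R) : Prop :=
  forall Q : prime_idealr R, [set` Q] `<=` [set` P] -> [set` Q] = [set` P].

Definition prime_chain (n : nat) (P : nat -> prime_idealr R) : Prop :=
  forall i, (i < n)%N -> [set` P i] `<` [set` P i.+1].

(* [has_krull_dim n] means dim R = n; no [n] satisfies it when dim R is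
   infinite. *)
Definition has_krull_dim (n : nat) : Prop :=
  (exists P, prime_chain n P) /\
  forall k P, prime_chain k P -> (k <= n)%N.

Definition regular_sequence s : Prop :=
  (forall i, (i < size s)%N ->
     forall a, ideal_of (take i s) (a * s`_i) -> ideal_of (take i s) a) /\
  ~ ideal_of s 1.

Definition has_depth (m : idealr R) (n : nat) : Prop :=
  let regular_in_m s := regular_sequence s /\ {subset s <= m} in
  (exists2 s, regular_in_m s & size s = n) /\
  forall s, regular_in_m s -> (size s <= n)%N.

Definition cohen_macaulay_local (m : idealr R) : Prop :=
  [/\ local_ring m, noetherian & exists2 n, has_krull_dim n & has_depth m n].

Definition system_of_parameters (m : idealr R) s : Prop :=
  has_krull_dim (size s) /\ radical (ideal_of s) = [set` m].

Definition frobenius_power I (q : nat) : set R :=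
  ideal_span [set a ^+ q | a in I].

Definition tight_closure (p : nat) I : set R :=
  [set x | exists2 c : R,
     forall P : prime_idealr R, minimal_prime P -> c \notin P
     & exists e0, forall e, (e0 <= e)%N ->
         frobenius_power I (p ^ e) (c * x ^+ (p ^ e))].

Definition contains_field_of_char (p : nat) : Prop :=
  exists (K : fieldType) (f : {rmorphism K -> R}),
    injective f /\ p \in [pchar K].

End Ideals.

Definition equidimensional (R : comNzRingType) : Prop :=
  forall P : prime_idealr R, minimal_prime P ->
  forall n, has_krull_dim {ideal_quot P} n <-> has_krull_dim R n.

Definition image_of_cohen_macaulay_local (R : comNzRingType) : Prop :=
  exists (A : comNzRingType) (m : idealr A) (f : {rmorphism A -> R}),
    cohen_macaulay_local m /\ range f = [set: R].

(* Main.v *)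
From HB Require Import structures.
Require Import Defs.
From mathcomp Require Import all_boot all_algebra ring_quotient ring zify.
From mathcomp Require Import boolp classical_sets.

(** Write [R = A/J] with [A] Cohen-Macaulay local, and divide [A] by a regular
    sequence of elements of [J] that is as long as possible; let [Y] be the ideal
    it generates. By equidimensionality the minimal primes of [R] become minimal
    and associated primes of [A/Y], and the parameters [x_i] lift to a sequence
    that is regular on [A/Y] (prime avoidance in the cosets [x_i + J]).

    The heart is a uniform colon killer: some [c] outside all minimal primes of
    [R] satisfies [c (x_1^q,...,x_s^q)^n : x_(s+1)^r <= (x_1^q,...,x_s^q)^n] for
    all [q], [r] and [n] at once. It is obtained by killing the modules
    Tor_1(B/K, B/L), with [B = A/Y] and [K] a power of [(x_1^q,...,x_s^q)], by
    induction on [s] and noetherian induction on [L]. The only case where nothing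
    is immediate is [L = P] the minimal prime itself; there [P = (Y : b)], and the
    relations modulo [P] are obtained from those modulo [Y + (b)] for [s - 1].

    For tight closure the killer is applied to [c_0 z^q x^q]. For integral closure
    it gives [c z^(m+k)] in [I^m] for all [m]; as the Rees algebra of [I] is
    noetherian, one of these elements is a combination of the earlier ones, and
    cancelling [c] modulo every minimal prime shows that the value at [z] of a
    polynomial of integral dependence is nilpotent. *)

Set Implicit Arguments.
Unset Strict Implicit.
Unset Printing Implicit Defensive.

Import GRing.Theory.
Local Open Scope classical_set_scope.
Local Open Scope ring_scope.

(** * Ideals and associated primes *)

Section IdealTheory.
Variable R : comNzRingType.
Implicit Types (I J K L P Q : set R) (a b r u v : R) (s : seq R).

Lemma is_ideal0 I : is_ideal I -> I 0. Proof. by case. Qed.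

Lemma is_idealD I a b : is_ideal I -> I a -> I b -> I (a + b).
Proof. by case=> _ + _; apply. Qed.

Lemma is_idealMl I a b : is_ideal I -> I b -> I (a * b).
Proof. by case=> _ _; apply. Qed.

Lemma is_idealMr I a b : is_ideal I -> I a -> I (a * b).
Proof. by rewrite mulrC; apply: is_idealMl. Qed.

Lemma is_idealN I a : is_ideal I -> I a -> I (- a).
Proof. by rewrite -mulN1r; apply: is_idealMl. Qed.

Lemma is_idealB I a b : is_ideal I -> I a -> I b -> I (a - b).
Proof. by move=> iI Ia Ib; apply: is_idealD => //; apply: is_idealN. Qed.

Lemma is_idealX I a n : is_ideal I -> (0 < n)%N -> I a -> I (a ^+ n).
Proof. by case: n => // n iI _ Ia; rewrite exprS; apply: is_idealMr. Qed.

Lemma is_ideal_sum (T : Type) (r : seq T) (F : T -> R) I :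
  is_ideal I -> (forall i, I (F i)) -> I (\sum_(i <- r) F i).
Proof.
by move=> iI IF; apply: big_ind => //; [exact: is_ideal0 | move=> *; exact: is_idealD].
Qed.

Lemma is_idealT : is_ideal [set: R]. Proof. by split. Qed.

Lemma is_ideal_zero : is_ideal [set (0 : R)].
Proof. by split=> // [a b -> ->|a b ->]; rewrite ?addr0 ?mulr0. Qed.

Lemma is_ideal1 I : is_ideal I -> I 1 -> I = [set: R].
Proof.
move=> iI I1; apply/seteqP; split=> // a _.
by rewrite -[a]mulr1; apply: is_idealMl.
Qed.

Lemma is_ideal_span (A : set R) : is_ideal (ideal_span A).
Proof.
split=> [M [iM _]|a b Ha Hb M MP|a b Hb M MP]; first exact: is_ideal0.
  by apply: is_idealD; [case: MP | exact: Ha | exact: Hb].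
by apply: is_idealMl; [case: MP | exact: Hb].
Qed.

Lemma ideal_span_sub (A : set R) J : is_ideal J -> A `<=` J -> ideal_span A `<=` J.
Proof. exact: smallest_sub. Qed.

Lemma ideal_span_gen (A : set R) : A `<=` ideal_span A.
Proof. exact: sub_gen_smallest. Qed.

Lemma is_ideal_of s : is_ideal (ideal_of s). Proof. exact: is_ideal_span. Qed.

Lemma ideal_of_mem s a : a \in s -> ideal_of s a.
Proof. by move=> sa; apply: ideal_span_gen. Qed.

Lemma ideal_of_sub s J : is_ideal J -> (forall a, a \in s -> J a) -> ideal_of s `<=` J.
Proof. by move=> iJ sJ; apply: ideal_span_sub => // a /sJ. Qed.

Definition addi I a : set R := [set u | exists2 i, I i & exists r, u = i + r * a].

Lemma is_ideal_addi I a : is_ideal I -> is_ideal (addi I a).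
Proof.
move=> iI; split; first by exists 0; [exact: is_ideal0 | exists 0; rewrite mul0r addr0].
  move=> _ _ [i Ii [r ->]] [j Ij [q ->]]; exists (i + j); first exact: is_idealD.
  by exists (r + q); ring.
move=> c _ [i Ii [r ->]]; exists (c * i); first exact: is_idealMl.
by exists (c * r); ring.
Qed.

Lemma sub_addi I a : I `<=` addi I a.
Proof. by move=> u Iu; exists u => //; exists 0; rewrite mul0r addr0. Qed.

Lemma addi_gen I a : is_ideal I -> addi I a a.
Proof. by move=> iI; exists 0; [exact: is_ideal0 | exists 1; rewrite mul1r add0r]. Qed.

Lemma addi_sub I a J : is_ideal J -> I `<=` J -> J a -> addi I a `<=` J.
Proof.
by move=> iJ IJ Ja _ [i Ii [r ->]]; apply: is_idealD => //; [exact: IJ|exact: is_idealMl].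
Qed.

Lemma addiC I a b : addi (addi I a) b = addi (addi I b) a.
Proof.
apply/seteqP; split=> _ [_ [i Ii [r ->]] [q ->]].
  by exists (i + q * b); [exists i => //; exists q | exists r; ring].
by exists (i + q * a); [exists i => //; exists q | exists r; ring].
Qed.

Lemma ideal_of_nil : ideal_of [::] = [set (0 : R)].
Proof.
apply/seteqP; split; first by apply: ideal_of_sub => //; exact: is_ideal_zero.
by move=> _ ->; apply: is_ideal0; exact: is_ideal_of.
Qed.

Lemma ideal_of_cons a s : ideal_of (a :: s) = addi (ideal_of s) a.
Proof.
apply/seteqP; split.
  apply: ideal_of_sub; first exact/is_ideal_addi/is_ideal_of.
  move=> b; rewrite in_cons => /predU1P[->|sb].
    by apply: addi_gen; exact: is_ideal_of.
  by apply: sub_addi; exact: ideal_of_mem.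
apply: addi_sub; first exact: is_ideal_of.
  apply: ideal_of_sub; first exact: is_ideal_of.
  by move=> b sb; apply: ideal_of_mem; rewrite in_cons sb orbT.
by apply: ideal_of_mem; rewrite mem_head.
Qed.

Lemma ideal_of_eq_mem s t : s =i t -> ideal_of s = ideal_of t.
Proof.
by move=> st; congr ideal_span; apply/seteqP; split=> a /=; rewrite st.
Qed.

Lemma ideal_of_subset s t : {subset s <= t} -> ideal_of s `<=` ideal_of t.
Proof.
by move=> st; apply: ideal_of_sub => [|a /st]; [exact: is_ideal_of|exact: ideal_of_mem].
Qed.

Lemma ideal_of_mkseq (g : nat -> R) N u :
  ideal_of (mkseq g N) u -> exists r : nat -> R, u = \sum_(i < N) r i * g i.
Proof.
apply: (ideal_of_sub (J := [set u | exists r : nat -> R, u = \sum_(i < N) r i * g i])).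
  split=> [|_ _ [r ->] [q ->]|c _ [r ->]].
  - by exists (fun=> 0); rewrite big1 // => i _; rewrite mul0r.
  - exists (fun i => r i + q i); rewrite -big_split.
    by apply: eq_bigr => i _; rewrite mulrDl.
  - by exists (fun i => c * r i); rewrite mulr_sumr; apply: eq_bigr => i _; rewrite mulrA.
move=> a /mapP[j]; rewrite mem_iota add0n => /andP[_ jN] ->.
exists (fun i => (i == j)%:R); rewrite (bigD1 (Ordinal jN)) //= eqxx mul1r big1 ?addr0 //.
by move=> i; rewrite -val_eqE /= => /negPf ->; rewrite mul0r.
Qed.

Lemma is_ideal_colon I b : is_ideal I -> is_ideal (colon I b).
Proof.
move=> iI; rewrite /colon; split=> /= [|a c Ia Ic|a c Ic].
- by rewrite mul0r; exact: is_ideal0.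
- by rewrite mulrDl; exact: is_idealD.
- by rewrite -mulrA; exact: is_idealMl.
Qed.

Lemma sub_colon I b : is_ideal I -> I `<=` colon I b.
Proof. by move=> iI a Ia; exact: is_idealMr. Qed.

Lemma colonM I a b : colon (colon I b) a = colon I (a * b).
Proof. by apply/seteqP; split=> u; rewrite /colon /= mulrA. Qed.

Definition nzd I a : Prop := colon I a `<=` I.

Lemma nzdX I a n : nzd I a -> nzd I (a ^+ n).
Proof.
move=> Ia; elim: n => [|n IHn] u; rewrite /colon /=; first by rewrite mulr1.
by rewrite exprSr mulrA => /Ia; exact: IHn.
Qed.

Definition is_prime P : Prop :=
  [/\ is_ideal P, ~ P 1 & forall a b, P (a * b) -> P a \/ P b].

Lemma is_primeX P a n : is_prime P -> P (a ^+ n) -> P a.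
Proof.
move=> [iP P1 PM]; elim: n => [|n IHn]; first by rewrite expr0 => /P1.
by rewrite exprS => /PM[].
Qed.

Definition assoc I Q : Prop := is_prime Q /\ exists b, Q = colon I b.

Lemma assoc_sub I Q : is_ideal I -> assoc I Q -> I `<=` Q.
Proof. by move=> iI [_ [b ->]]; exact: sub_colon. Qed.

Lemma nzd_not_assoc I Q a : nzd I a -> assoc I Q -> ~ Q a.
Proof.
move=> Ia [[_ Q1 _] [b Eb]]; rewrite Eb /colon /= mulrC => /Ia Ib.
by apply: Q1; rewrite Eb /colon /= mul1r.
Qed.

(** * Noetherian induction and finiteness of associated primes *)

Section Noetherian.
Hypothesis noethR : noetherian R.

(** A failing ideal could be strictly enlarged forever; the union of such a chain is finitely
    generated, and its generators already lie in one member. *)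
Lemma noeth_ind (Phi : set R -> Prop) :
  (forall I, is_ideal I -> (forall J, is_ideal J -> I `<` J -> Phi J) -> Phi I) ->
  forall I, is_ideal I -> Phi I.
Proof.
move=> step; apply: contrapT => /existsNP[I0 /not_implyP[iI0 nPhi0]].
pose T := {I : set R | is_ideal I /\ ~ Phi I}.
have next (I : T) : {J : T | sval I `<` sval J}.
  apply: cid; case: I => I [iI nPhiI] /=; apply: contrapT => nJ.
  apply/nPhiI/step => // J iJ IJ; apply: contrapT => nPhiJ.
  by apply: nJ; exists (exist _ J (conj iJ nPhiJ)).
pose c n := iter n (fun J : T => sval (next J)) (exist _ I0 (conj iI0 nPhi0) : T).
have cS n : sval (c n) `<` sval (c n.+1) by rewrite /c iterS; exact: (svalP (next _)).
have c_homo n k : sval (c n) `<=` sval (c (n + k)%N).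
  elim: k => [|k IHk]; first by rewrite addn0.
  by rewrite addnS; apply: subset_trans IHk _; case: (cS (n + k)%N).
have iU : is_ideal (\bigcup_n sval (c n)).
  split; first by exists 0%N => //; exact: is_ideal0.
    move=> a b [n _ na] [k _ kb]; exists (n + k)%N => //.
    apply: is_idealD; first by case: (svalP (c (n + k)%N)).
      exact: c_homo na.
    by rewrite addnC; exact: c_homo kb.
  by move=> a b [n _ nb]; exists n => //; apply: is_idealMl => //; case: (svalP (c n)).
have [s Us] := noethR iU.
suff [n sn] : exists n, forall a, a \in s -> sval (c n) a.
  case: (cS n) => _; apply => a na.
  have : (\bigcup_n sval (c n)) a by exists n.+1.
  by rewrite Us; apply: ideal_of_sub => //; case: (svalP (c n)).
have: forall a, a \in s -> (\bigcup_n sval (c n)) a by rewrite Us; exact: ideal_of_mem.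
elim: s {Us} => [|a s IHs] sU; first by exists 0%N.
have [|n nP] := IHs; first by move=> b sb; apply: sU; rewrite in_cons sb orbT.
have [k _ ka] := sU a (mem_head _ _); exists (n + k)%N => b.
rewrite in_cons => /predU1P[->|/nP]; first by rewrite addnC; exact: c_homo.
exact: c_homo.
Qed.

Lemma noeth_max (F : set (set R)) I : F `<=` @is_ideal R -> F I ->
  exists J, [/\ F J, I `<=` J & forall K, F K -> J `<=` K -> K = J].
Proof.
move=> Fid FI; have iI := Fid _ FI; move: I iI FI; apply: noeth_ind => I iI IH FI.
have [[J [FJ IJ nJI]]|nJ] := pselect (exists J, [/\ F J, I `<=` J & ~ (J `<=` I)]).
  have [K [FK JK maxK]] := IH J (Fid _ FJ) (conj IJ nJI) FJ.
  by exists K; split=> //; exact: subset_trans JK.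
exists I; split=> // K FK IK; apply/seteqP; split=> //.
by apply: contrapT => nKI; apply: nJ; exists K.
Qed.

Lemma noeth_seq (g : nat -> R) : exists N, ideal_of (mkseq g N) (g N).
Proof.
have [||J [[N _ <-] _ maxN]] := @noeth_max
    (range (fun n => ideal_of (mkseq g n))) (ideal_of (mkseq g 0)).
- by move=> _ [n _ <-]; exact: is_ideal_of.
- by exists 0%N => //.
exists N; rewrite -(maxN (ideal_of (mkseq g N.+1))).
- by apply: ideal_of_mem; rewrite map_f // mem_iota add0n ltnS leqnn.
- by exists N.+1 => //.
apply: ideal_of_subset => a /mapP[i]; rewrite mem_iota add0n => /andP[_ iN] ->.
by rewrite map_f // mem_iota add0n leqW.
Qed.

(** A colon [Q = (I : b)] maximal among those inside [Q0] is prime. Let [u * v] be in [Q] and [u]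
    not. If [(I : u b)] stays inside [Q0], it equals [Q] and contains [v]. Otherwise some [t]
    outside [Q0] has [t u b] in [I]; then [(I : t b)] is still inside [Q0], hence equals [Q], yet
    contains [u]. *)
Lemma assoc_below I Q0 : is_ideal I -> is_prime Q0 -> I `<=` Q0 ->
  exists2 Q, assoc I Q & Q `<=` Q0.
Proof.
move=> iI [iQ0 Q01 Q0M] IQ0.
pose F := [set Q | exists2 b, Q = colon I b & Q `<=` Q0].
have [||Q [[b Eb QQ0] _ maxQ]] := @noeth_max F I.
- by move=> _ [b -> _]; exact: is_ideal_colon.
- by exists 1 => //; apply/seteqP; split=> u; rewrite /colon /= mulr1.
exists Q => //; split; last by exists b.
split=> [||u v Quv]; first by rewrite Eb; exact: is_ideal_colon.
  by move/QQ0.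
have [|Qu] := pselect (Q u); first by left.
right; have [ubQ0|] := pselect (colon I (u * b) `<=` Q0).
  rewrite -(maxQ (colon I (u * b))).
  - by rewrite /colon /= mulrCA mulrA; move: Quv; rewrite Eb.
  - by exists (u * b).
  - by rewrite -colonM -Eb; apply: sub_colon; rewrite Eb; exact: is_ideal_colon.
move/existsNP => [t /not_implyP[It nQ0t]].
case: Qu; rewrite -(maxQ (colon I (t * b))).
- by move: It; rewrite /colon /= mulrCA.
- exists (t * b) => // w; rewrite /colon /= mulrA => Iw.
  have /Q0M[//|/nQ0t//] : Q0 (w * t) by apply: QQ0; rewrite Eb.
- by rewrite -colonM -Eb; apply: sub_colon; rewrite Eb; exact: is_ideal_colon.
Qed.

Lemma prime_above I : is_ideal I -> ~ I 1 -> exists2 Q, is_prime Q & I `<=` Q.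
Proof.
move=> iI I1; have [||Q [[iQ Q1] IQ maxQ]] := @noeth_max [set J | is_ideal J /\ ~ J 1] I.
- by move=> J [].
- by [].
exists Q => //; split=> // u v Quv; have [|nQu] := pselect (Q u); first by left.
right; apply: contrapT => nQv.
have Q' : addi Q u = [set: R].
  apply: is_ideal1; first exact: is_ideal_addi.
  apply: contrapT => n1; apply: nQu; rewrite -(maxQ (addi Q u)).
  - exact: addi_gen.
  - by split=> //; exact: is_ideal_addi.
  - exact: sub_addi.
have : addi Q u 1 by rewrite Q'.
move=> [i Qi [r E]]; apply: nQv; rewrite -[v]mul1r E.
have -> : (i + r * u) * v = v * i + r * (u * v) by ring.
by apply: is_idealD => //; apply: is_idealMl.
Qed.

(** A maximal member of the proper colons [(I : t b)] above [(I : b)] is prime. *)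
Lemma assoc_zero_divisor I b : is_ideal I -> ~ I b ->
  exists2 Q, assoc I Q & colon I b `<=` Q.
Proof.
move=> iI nIb; have iIb := @is_ideal_colon I b iI.
have [|Q0 Q0P IQ0] := prime_above iIb; first by rewrite /colon /= mul1r.
pose F := [set Q | ~ Q 1 /\ exists t, Q = colon I (t * b)].
have [||Q [[Q1 [t Et]] bQ maxQ]] := @noeth_max F (colon I b).
- by move=> _ [_ [t ->]]; exact: is_ideal_colon.
- by split; [rewrite /colon /= mul1r | exists 1; rewrite mul1r].
exists Q => //; split; last by exists (t * b).
split=> // [|u v Quv]; first by rewrite Et; exact: is_ideal_colon.
have [|nQu] := pselect (Q u); first by left.
right; rewrite -(maxQ (colon I (u * t * b))).
- by move: Quv; rewrite Et /colon /= => H; rewrite -mulrA mulrCA mulrA.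
- split; last by exists (u * t).
  by rewrite /colon /= mul1r -mulrA; move: nQu; rewrite Et.
- by rewrite -mulrA -colonM -Et; apply: sub_colon; rewrite Et; exact: is_ideal_colon.
Qed.

Lemma not_nzd_assoc I a : is_ideal I -> ~ nzd I a -> exists2 Q, assoc I Q & Q a.
Proof.
move=> iI /existsNP[b /not_implyP[Iba nIb]].
have [Q QP bQ] := assoc_zero_divisor iI nIb.
by exists Q => //; apply: bQ; rewrite /colon /= mulrC.
Qed.

(** In [R/I] the classes of [e] and [b] generate copies of [R/Q'] and [R/Q]. If these meet, a
    nonzero common element has both [Q'] and [Q] as its annihilator; if not, [e] has the same
    annihilator modulo [I + (b)] as modulo [I]. *)
Lemma assoc_addi I Q Q' b : is_ideal I -> Q = colon I b -> is_prime Q ->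
  assoc I Q' -> Q' = Q \/ assoc (addi I b) Q'.
Proof.
move=> iI Eb [_ Q1 QM] [Q'P [e Ee]]; have [iQ' Q'1 Q'M] := Q'P.
have [[t [tb nte]]|ntb] := pselect (exists t, addi I b (t * e) /\ ~ I (t * e)).
  left; move: tb => [i Ii [r E]]; apply/seteqP; split=> u Hu.
    have : Q (u * r).
      rewrite Eb /colon /= -mulrA.
      have -> : u * (r * b) = u * (t * e) - u * i by rewrite E; ring.
      apply: is_idealB => //; last exact: is_idealMl.
      by rewrite mulrCA; apply: is_idealMl => //; move: Hu; rewrite Ee.
    move=> /QM[//|]; rewrite Eb /colon /= => rb; case: nte.
    by rewrite E; apply: is_idealD.
  have : Q' (u * t).
    rewrite Ee /colon /= -mulrA E mulrDr; apply: is_idealD => //.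
      exact: is_idealMl.
    by rewrite mulrCA; apply: is_idealMl => //; move: Hu; rewrite Eb.
  by move=> /Q'M[//|]; rewrite Ee.
right; split=> //; exists e; rewrite Ee; apply/seteqP; split=> t; rewrite /colon /=.
  exact: sub_addi.
by move=> tb; apply: contrapT => nte; apply: ntb; exists t.
Qed.

(** By [assoc_addi], passing from [I] to the larger ideal [I + (b)] loses at most one associated
    prime. *)
Lemma assoc_finite I : is_ideal I ->
  exists Qs : seq (set R), forall Q, assoc I Q <-> Q \in Qs.
Proof.
move=> iI; suff [Qs QsP] : exists Qs : seq (set R), forall Q, assoc I Q -> Q \in Qs.
  exists [seq Q <- Qs | `[< assoc I Q >]] => Q; rewrite mem_filter.
  by split=> [QP|/andP[/asboolP]//]; rewrite QsP // andbT; apply/asboolP.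
move: I iI; apply: noeth_ind => I iI IH.
have [I1|nI1] := pselect (I 1).
  by exists [::] => Q [[_ Q1 _] [b Eb]]; case: Q1; rewrite Eb; exact: sub_colon.
have [Q QP _] := assoc_zero_divisor iI nI1; have [[iQ Q1 _] [b Eb]] := QP.
have [||Qs QsP] := IH (addi I b); first exact: is_ideal_addi.
  split; first exact: sub_addi.
  move=> /(_ _ (addi_gen b iI)) Ib; apply: Q1.
  by rewrite Eb /colon /= mul1r.
exists (Q :: Qs) => Q' Q'P; rewrite in_cons.
have [->|/QsP ->] := assoc_addi iI Eb QP.1 Q'P; first by rewrite eqxx.
by rewrite orbT.
Qed.

End Noetherian.

(* Avoiding a prime avoids the smaller ones, so the list may be taken to have no
   member contained in its head. *)
Lemma coset_avoidance (Qs : seq (set R)) J x : is_ideal J ->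
  (forall Q, Q \in Qs -> is_prime Q) ->
  (forall Q, Q \in Qs -> Q x -> ~ (J `<=` Q)) ->
  exists2 j, J j & forall Q, Q \in Qs -> ~ Q (x + j).
Proof.
move=> iJ; have [n] := ubnP (size Qs); elim: n Qs => // n IHn.
case=> [|Q Qs] /=; first by exists 0; [exact: is_ideal0|].
rewrite ltnS => szQs Qprime QJ.
have [[Q' Q'Qs Q'Q]|incomp] := pselect (exists2 Q', Q' \in Qs & Q' `<=` Q).
  have sub Q1 : Q1 \in Q :: [seq Q1 <- Qs | Q1 != Q'] -> Q1 \in Q :: Qs.
    by rewrite !in_cons mem_filter => /orP[->//|/andP[_ ->]]; rewrite orbT.
  have [|Q1 /sub|Q1 /sub|j Jj jP] := IHn (Q :: [seq Q1 <- Qs | Q1 != Q']).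
  - rewrite /= size_filter; apply: leq_trans szQs; rewrite ltnS -[size Qs](count_predC (pred1 Q')).
    by rewrite -[X in (X < _)%N]add0n ltn_add2r -has_count has_pred1.
  - exact: Qprime.
  - exact: QJ.
  exists j => // Q1; have [->|nQ1] := eqVneq Q1 Q'.
    by move=> _ /Q'Q; apply: jP; exact: mem_head.
  by move=> Q1Qs; apply: jP; move: Q1Qs; rewrite !in_cons mem_filter nQ1.
have [||j Jj jP] := IHn Qs szQs.
- by move=> Q1 Q1P; apply: Qprime; rewrite in_cons Q1P orbT.
- by move=> Q1 Q1P; apply: QJ; rewrite in_cons Q1P orbT.
have [Qxj|nQxj] := pselect (Q (x + j)); last first.
  by exists j => // Q1; rewrite in_cons => /predU1P[->//|/jP].
have [iQ Q1 QM] := Qprime Q (mem_head _ _).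
have nJQ : ~ (J `<=` Q).
  move=> JQ; apply: (QJ Q (mem_head _ _)) => //.
  by have := is_idealB iQ Qxj (JQ _ Jj); rewrite addrK.
have [v /not_implyP[Jv nQv]] : exists v, ~ (J v -> Q v) by apply/existsNP.
have Qs_ideal Q' : Q' \in Qs -> is_ideal Q'.
  by move=> Q'P; have [] := Qprime Q'; rewrite // in_cons Q'P orbT.
(* As [w] lies in every other prime but not in [Q], adding [v * w] takes [x + j] out of [Q] and
   changes nothing modulo the others. *)
have [w wQs nQw] : exists2 w, (forall Q', Q' \in Qs -> Q' w) & ~ Q w.
  have : forall Q', Q' \in Qs -> is_ideal Q' /\ ~ (Q' `<=` Q).
    by move=> Q' Q'P; split; [exact: Qs_ideal | move=> Q'Q; apply: incomp; exists Q'].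
  elim: (Qs) => [_|Q' Qs' IH QsP]; first by exists 1.
  have [|w wQs nQw] := IH; first by move=> ? H; apply: QsP; rewrite in_cons H orbT.
  have [iQ' /existsNP[z /not_implyP[Q'z nQz]]] := QsP Q' (mem_head _ _).
  exists (z * w); last by move=> /QM[].
  move=> Q2; rewrite in_cons => /predU1P[->|Q2P]; first exact: is_idealMr.
  apply: is_idealMl; last exact: wQs.
  by case: (QsP Q2) => //; rewrite in_cons Q2P orbT.
exists (j + v * w); first by apply: is_idealD => //; exact: is_idealMr.
move=> Q'; rewrite in_cons addrA => /predU1P[->|Q'Qs] Q'xjvw.
  by have := is_idealB iQ Q'xjvw Qxj; rewrite [x + j + _]addrC addrK => /QM[].
apply: (jP _ Q'Qs); have iQ' := Qs_ideal _ Q'Qs.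
rewrite -[x + j](addrK (v * w)); apply: is_idealB => //.
by apply: is_idealMl => //; exact: wQs.
Qed.

Lemma prime_avoidance (Qs : seq (set R)) J : is_ideal J ->
  (forall Q, Q \in Qs -> is_prime Q) -> (forall Q, Q \in Qs -> ~ (J `<=` Q)) ->
  exists2 j, J j & forall Q, Q \in Qs -> ~ Q j.
Proof.
move=> iJ Qprime QJ; have [|j Jj jP] := @coset_avoidance Qs J 0 iJ Qprime.
  by move=> Q /QJ.
by exists j => // Q /jP; rewrite add0r.
Qed.

(** Induction on the generators: the equation of the first one, [x], can be solved for [x] because
    [1 - r * a] is a unit, and substituting the solution leaves equations of the same shape for the
    rest. *)
Lemma nakayama I s a : is_ideal I -> (forall r, exists v, v * (1 - r * a) = 1) ->
  (forall l, l \in s -> exists i j, [/\ I i, ideal_of s j & l = i + a * j]) ->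
  forall l, l \in s -> I l.
Proof.
move=> iI jac; elim: s => // x s IHs sP.
have [i [j [Ii + Ex]]] := sP x (mem_head _ _).
rewrite ideal_of_cons => -[j' sj' [r Ej]].
have [v vE] := jac r.
have xE : x = v * i + a * (v * j').
  have E : (1 - r * a) * x = i + a * j' by rewrite mulrBl mul1r {1}Ex Ej; ring.
  by rewrite -{1}[x]mul1r -vE -mulrA E; ring.
have sI l : l \in s -> I l.
  apply: IHs => {}l sl.
  have [i1 [j1 [Ii1 + ->]]] := sP l (mem_behead (s := x :: s) sl).
  rewrite ideal_of_cons => -[j1' sj1' [r1 ->]].
  exists (i1 + a * r1 * (v * i)), (j1' + r1 * a * v * j'); split.
  - exact: is_idealD iI Ii1 (is_idealMl _ iI (is_idealMl _ iI Ii)).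
  - exact: is_idealD (is_ideal_of s) sj1' (is_idealMl _ (is_ideal_of s) sj').
  - by rewrite {1}xE; ring.
move=> l; rewrite in_cons => /predU1P[->|/sI//]; rewrite xE.
have Ij' : I j' by apply: ideal_of_sub sj'.
exact: is_idealD iI (is_idealMl _ iI Ii) (is_idealMl _ iI (is_idealMl _ iI Ij')).
Qed.

End IdealTheory.

(** * Depth and systems of parameters *)

Section Depth.
Variable R : comNzRingType.
Implicit Types (I J K L P Q : set R) (a b r u v : R) (s : seq R).

(** Properness of the last quotient is not part of this notion; over a local ring it is automatic
    when [I] is proper and the elements are in the maximal ideal. *)
Fixpoint reg I s : Prop :=
  if s is a :: s' then nzd I a /\ reg (addi I a) s' else True.

Lemma nzd_addi_swap I a b : is_ideal I -> nzd I a -> nzd (addi I a) b ->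
  nzd (addi I b) a.
Proof.
move=> iI Ia Iab u [i Ii [v E]].
have [|i' Ii' [w Ev]] := Iab v; first by exists (- i); [exact: is_idealN|exists u; rewrite E; ring].
have : colon I a (u - w * b).
  rewrite /colon /= mulrBl E Ev.
  have -> : i + (i' + w * a) * b - w * b * a = i + i' * b by ring.
  by apply: is_idealD => //; exact: is_idealMr.
by move/Ia => Iuw; exists (u - w * b) => //; exists w; ring.
Qed.

Section Local.
Variable m : set R.
Hypotheses (noethR : noetherian R) (m_ideal : is_ideal m).
Hypotheses (m_max : forall I, is_ideal I -> ~ I 1 -> I `<=` m) (m1 : ~ m 1).

Definition depth_ge I k : Prop :=
  exists s, [/\ size s = k, (forall a, a \in s -> m a) & reg I s].

Lemma local_unit a : m a -> forall r, exists v, v * (1 - r * a) = 1.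
Proof.
move=> ma r; apply: contrapT => nv.
have : ideal_of [:: 1 - r * a] `<=` m.
  apply: m_max; first exact: is_ideal_of.
  rewrite ideal_of_cons ideal_of_nil => -[_ -> [v]]; rewrite add0r => Ev.
  by apply: nv; exists v.
move=> /(_ (1 - r * a)) H; apply: m1; rewrite -[1](subrK (r * a)).
apply: is_idealD => //; last exact: is_idealMl.
by apply: H; apply: ideal_of_mem; exact: mem_head.
Qed.

Lemma local_nakayama I L a : is_ideal I -> is_ideal L -> m a ->
  (forall l, L l -> exists i j, [/\ I i, L j & l = i + a * j]) -> L `<=` I.
Proof.
move=> iI iL ma LP; have [s Es] := noethR iL; rewrite Es.
apply: ideal_of_sub => //; apply: (@nakayama _ _ _ a) => //; first exact: local_unit.
by move=> l sl; rewrite -Es; apply: LP; rewrite Es; exact: ideal_of_mem.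
Qed.

(** If [l * b] is in [I], then [l = i + r * a] by regularity of [b] modulo [I + (a)], and [r * b] is
    in [I] by regularity of [a]. So [(I : b)] is contained in [I + a (I : b)], and Nakayama
    applies. *)
Lemma nzd_addi_drop I a b : is_ideal I -> m a -> nzd I a -> nzd (addi I a) b -> nzd I b.
Proof.
move=> iI ma Ia Iab; apply: (@local_nakayama _ _ a) => //; first exact: is_ideal_colon.
move=> l; rewrite /colon /= => Il.
have [|i Ii [r E]] := Iab l; first exact: sub_addi.
exists i, r; split=> //; last by rewrite E mulrC.
apply: Ia; rewrite /colon /=.
have -> : r * b * a = l * b - i * b by rewrite E; ring.
by apply: is_idealB => //; exact: is_idealMr.
Qed.

(** Two ideals are treated at once because [depth_ge_exchange] needs a single element regular modulo
    both; elsewhere [I1] and [I2] coincide. *)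
Lemma coset_nzd I1 I2 J x : is_ideal I1 -> is_ideal I2 -> is_ideal J ->
  (forall Q, assoc I1 Q \/ assoc I2 Q -> Q x -> ~ (J `<=` Q)) ->
  exists2 j, J j & nzd I1 (x + j) /\ nzd I2 (x + j).
Proof.
move=> iI1 iI2 iJ JQ; have [Qs1 Qs1P] := assoc_finite noethR iI1.
have [Qs2 Qs2P] := assoc_finite noethR iI2.
have QsP Q : Q \in Qs1 ++ Qs2 -> assoc I1 Q \/ assoc I2 Q.
  by rewrite mem_cat => /orP[/Qs1P|/Qs2P]; [left|right].
have [||j Jj jP] := @coset_avoidance _ (Qs1 ++ Qs2) J x iJ.
- by move=> Q /QsP[[]|[]].
- by move=> Q /QsP /JQ.
exists j => //; split; apply: contrapT => H.
  have [Q QP Qxj] := not_nzd_assoc noethR iI1 H.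
  by apply: jP Qxj; rewrite mem_cat; apply/orP; left; apply/Qs1P.
have [Q QP Qxj] := not_nzd_assoc noethR iI2 H.
by apply: jP Qxj; rewrite mem_cat; apply/orP; right; apply/Qs2P.
Qed.

Lemma assoc_sub_max I Q : assoc I Q -> Q `<=` m.
Proof. by move=> [[iQ Q1 _] _]; exact: m_max. Qed.

Lemma nzd_not_maximal I Q a : nzd I a -> m a -> assoc I Q -> ~ (m `<=` Q).
Proof. by move=> Ia ma QP /(_ _ ma); exact: nzd_not_assoc QP. Qed.

(** A common element [c], regular modulo both [I + (a)] and [I + (b)], links the two: by induction
    one passes from [I + (b, c1)] to [I + (b, c)], and from there to [I + (a, c)]. *)
Lemma depth_ge_exchange k I a b : is_ideal I -> m a -> m b -> nzd I a -> nzd I b ->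
  depth_ge (addi I b) k -> depth_ge (addi I a) k.
Proof.
elim: k I a b => [|k IHk] I a b iI ma mb Ia Ib; first by exists [::].
move=> [[|c1 s] [//= [sz] ms [Ic1 regs]]].
have mc1 : m c1 by apply: ms; exact: mem_head.
have iIa := is_ideal_addi a iI; have iIb := is_ideal_addi b iI.
have [|c mc [Iac Ibc]] := @coset_nzd (addi I a) (addi I b) m 0 iIa iIb m_ideal.
  (* If [m u] lies in [addi I a], write [b u = a u'] modulo [I]; then [m u'] lies
     in [addi I b], on which [c1] is regular. *)
  move=> Q [[QP [u Eu]]|QP] _ mQ; last exact: (nzd_not_maximal Ic1 mc1 QP).
  have [_ Q1 _] := QP.
  have [i Ii [u' E]] : addi I a (b * u) by have := mQ _ mb; rewrite Eu.
  apply: Q1; rewrite Eu /colon /= mul1r.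
  have [j Ij [w Ew]] : addi I b u'.
    apply: Ic1; rewrite /colon /= mulrC.
    have [i1 Ii1 [u1 E1]] : addi I a (c1 * u) by have := mQ _ mc1; rewrite Eu.
    have : colon I a (c1 * u' - u1 * b).
      rewrite /colon /=.
      have -> : (c1 * u' - u1 * b) * a = b * i1 - c1 * i.
        have -> : (c1 * u' - u1 * b) * a = c1 * (u' * a) - b * (u1 * a) by ring.
        have -> : u' * a = b * u - i by rewrite E addrC addKr.
        by have -> : u1 * a = c1 * u - i1; [rewrite E1 addrC addKr|ring].
      by apply: is_idealB => //; exact: is_idealMl.
    by move/Ia => H; exists (c1 * u' - u1 * b) => //; exists u1; ring.
  have : colon I b (u - w * a).
    rewrite /colon /=.
    have -> : (u - w * a) * b = i + j * a by rewrite mulrBl [u * b]mulrC E Ew; ring.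
    by apply: is_idealD => //; exact: is_idealMr.
  by move/Ib => H; exists (u - w * a) => //; exists w; ring.
rewrite add0r in Iac Ibc.
have Ica : nzd (addi I c) a by exact: nzd_addi_swap.
have Icb : nzd (addi I c) b by exact: nzd_addi_swap.
have [t [szt mt regt]] : depth_ge (addi (addi I a) c) k.
  rewrite addiC; apply: (IHk _ a b) => //; first exact: is_ideal_addi.
  rewrite addiC; apply: (IHk _ c c1) => //; exists s; split=> // d sd.
  by apply: ms; rewrite in_cons sd orbT.
exists (c :: t); split=> //=; first by rewrite szt.
by move=> d; rewrite in_cons => /predU1P[->|/mt].
Qed.

Lemma depth_ge_addi k I a : is_ideal I -> m a -> nzd I a ->
  depth_ge I k.+1 -> depth_ge (addi I a) k.
Proof.
move=> iI ma Ia [[|b s] [//= [sz] ms [Ib regs]]].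
have mb : m b by apply: ms; exact: mem_head.
apply: (@depth_ge_exchange _ _ a b) => //; exists s; split=> // d sd.
by apply: ms; rewrite in_cons sd orbT.
Qed.

(** The ideal [L = (I : Q)] contains [b]. Were it inside [I + (a)], regularity of [a] would put it
    inside [I + a L], hence inside [I] by Nakayama, forcing [b] into [I]. So some [u] in [L] is
    outside [I + (a)], and both [Q] and [a] kill it modulo [I + (a)]. *)
Lemma assoc_up I Q a : is_ideal I -> m a -> nzd I a -> assoc I Q ->
  exists Q', [/\ assoc (addi I a) Q', Q `<=` Q' & Q' a].
Proof.
move=> iI ma Ia [QP [b Eb]]; have [iQ Q1 _] := QP.
pose L := [set u | forall q, Q q -> I (q * u)].
have iL : is_ideal L.
  split=> [q _|u v Lu Lv q Qq|u v Lv q Qq]; first by rewrite mulr0; exact: is_ideal0.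
    by rewrite mulrDr; apply: is_idealD; [|exact: Lu|exact: Lv].
  by rewrite mulrCA; apply: is_idealMl => //; exact: Lv.
have [u /not_implyP[Lu nu]] : exists u, ~ (L u -> addi I a u).
  apply/existsNP => sub; apply: Q1; rewrite Eb /colon /= mul1r.
  apply: (@local_nakayama I L a) => // [l Ll|q]; last by rewrite Eb.
  have [i Ii [r E]] := sub l Ll; exists i, r; split=> //; last by rewrite E mulrC.
  move=> q Qq; apply: Ia; rewrite /colon /=.
  have -> : q * r * a = q * l - q * i by rewrite E; ring.
  by apply: is_idealB => //; [exact: Ll | exact: is_idealMl].
have [Q' Q'P uQ'] := assoc_zero_divisor noethR (is_ideal_addi a iI) nu.
exists Q'; split=> // [q Qq|]; apply: uQ'; rewrite /colon /=.
  by apply: sub_addi; exact: Lu.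
by rewrite mulrC; apply: is_idealMl; [exact: is_ideal_addi | exact: addi_gen].
Qed.

(** This is depth [R/I] <= dim [R/Q]: each regular element [a] moves [Q] up to a prime associated to
    [I + (a)], strictly since [a] is not in [Q]. *)
Lemma depth_ge_chain k I Q : is_ideal I -> depth_ge I k -> assoc I Q ->
  exists C : nat -> set R, [/\ C 0%N = Q, forall i, (i <= k)%N -> is_prime (C i) &
    forall i, (i < k)%N -> C i `<` C i.+1].
Proof.
elim: k I Q => [|k IHk] I Q iI dI QP; first by exists (fun=> Q); split=> // i _; case: QP.
have [s [szs ms regs]] := dI; case: s szs ms regs => // a s _ ms [Ia _].
have ma : m a by apply: ms; exact: mem_head.
have [Q' [Q'P QQ' Q'a]] := assoc_up iI ma Ia QP.
have [C [C0 Cp Cs]] := IHk _ _ (is_ideal_addi a iI) (depth_ge_addi iI ma Ia dI) Q'P.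
exists (fun i => if i is j.+1 then C j else Q); split=> // [[_|i /Cp//]|[_|i]].
- by case: QP.
- by rewrite C0; split=> // /(_ _ Q'a); exact: nzd_not_assoc QP.
- by rewrite ltnS; exact: Cs.
Qed.

Definition primary_mod I s : Prop :=
  forall u, m u -> exists e, foldl (@addi R) I s (u ^+ e).

Lemma foldl_addi_sub I J s : I `<=` J -> foldl (@addi R) I s `<=` foldl (@addi R) J s.
Proof.
elim: s I J => // a s IHs I J IJ; apply: IHs => _ [i Ii [r ->]].
by exists i; [exact: IJ | exists r].
Qed.

Lemma primary_mod_sub I J s : I `<=` J -> primary_mod I s -> primary_mod J s.
Proof. by move=> IJ Is u /Is[e He]; exists e; exact: foldl_addi_sub He. Qed.

Lemma primary_mod_cons Q Q' a s : is_ideal Q' -> Q `<=` Q' -> Q' a ->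
  primary_mod Q (a :: s) -> primary_mod Q' s.
Proof.
move=> iQ' QQ' Q'a Qs; apply: (@primary_mod_sub (addi Q a)) => //.
exact: addi_sub.
Qed.

(** The same bound with dim [R/Q] measured by parameters instead of chains. If an associated prime
    of [I] contains [Q] and [a], the shorter list already serves for it. Otherwise some [a + q] with
    [q] in [Q] is regular modulo [I], and [assoc_up] leads to a prime over [Q] that contains
    [a + q], hence [a]. *)
Lemma depth_le_primary k s I Q : is_ideal I -> depth_ge I k -> assoc I Q ->
  (forall a, a \in s -> m a) -> primary_mod Q s -> (k <= size s)%N.
Proof.
elim: s k I Q => [|a s IHs] k I Q iI dI QP ms Qs.
  case: k dI => // k [[|a s] [//= _ ms' [Ia _]]].
  have ma : m a by apply: ms'; exact: mem_head.
  by case: (nzd_not_maximal Ia ma QP) => u /Qs[e]; apply: is_primeX; case: QP.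
have ma : m a by apply: ms; exact: mem_head.
have ms' b : b \in s -> m b by move=> sb; apply: ms; rewrite in_cons sb orbT.
case: k dI => // k dI.
have [iQ _ _] := QP.1.
have [[Q2 [Q2P Q2a QQ2]]|nQ2] := pselect (exists Q2, [/\ assoc I Q2, Q2 a & Q `<=` Q2]).
  apply: leqW; apply: (IHs k.+1 I Q2) => //.
  by apply: primary_mod_cons Qs => //; case: Q2P => [[]].
have [Q2 [|//]|q Qq [Iaq _]] := @coset_nzd I I Q a iI iI iQ.
1,2: by move=> Q2P Q2a QQ2; apply: nQ2; exists Q2.
have maq : m (a + q) by apply: is_idealD => //; exact: assoc_sub_max QP _ Qq.
have [Q' [Q'P QQ' Q'aq]] := assoc_up iI maq Iaq QP.
have iQ' : is_ideal Q' by case: Q'P => [[]].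
rewrite /= ltnS; apply: (IHs _ _ Q' (is_ideal_addi _ iI) (depth_ge_addi iI maq Iaq dI)) => //.
apply: primary_mod_cons Qs => //.
by rewrite -[a](addrK q); apply: is_idealB => //; exact: QQ'.
Qed.

(** Avoidance in the coset [a + J] succeeds because an associated prime of [I] containing [J] and
    [a] would make the remaining [size s] elements primary modulo it, against depth [size s + 1]. *)
Lemma regular_lift J I s : is_ideal J -> J `<=` m -> is_ideal I ->
  depth_ge I (size s) -> (forall a, a \in s -> m a) ->
  (forall Q, is_prime Q -> J `<=` Q -> I `<=` Q -> primary_mod Q s) ->
  exists s', [/\ size s' = size s, forall i, J (s'`_i - s`_i) & reg I s'].
Proof.
move=> iJ Jm; elim: s I => [|a s IHs] I iI dI ms Js.
  by exists [::]; split=> // i; rewrite subrr; exact: is_ideal0.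
have ma : m a by apply: ms; exact: mem_head.
have ms' b : b \in s -> m b by move=> sb; apply: ms; rewrite in_cons sb orbT.
have Js_mem Q : is_prime Q -> J `<=` Q -> I `<=` Q -> Q a -> primary_mod Q s.
  move=> QP JQ IQ Qa; have := Js Q QP JQ IQ.
  by apply: primary_mod_cons => //; case: QP.
have [|j Jj [Iaj _]] := @coset_nzd I I J a iI iI iJ.
  move=> Q H Qa JQ; have {H} QP : assoc I Q by case: H.
  have := depth_le_primary iI dI QP ms' (Js_mem Q QP.1 JQ (assoc_sub iI QP) Qa).
  by rewrite ltnn.
have maj : m (a + j) by apply: is_idealD => //; exact: Jm.
have [|s' [szs' Js' regs']] := IHs _ (is_ideal_addi (a + j) iI) (depth_ge_addi iI maj Iaj dI) ms'.
  move=> Q QP JQ IQ; apply: Js_mem => //; first exact: subset_trans (@sub_addi _ _ _) IQ.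
  have iQ : is_ideal Q by case: QP.
  rewrite -[a](addrK j); apply: is_idealB => //; last exact: JQ.
  by apply: IQ; exact: addi_gen.
exists (a + j :: s'); split=> //=; first by rewrite szs'.
by case=> [|i] /=; rewrite ?Js' // [a + j]addrC addrK.
Qed.

End Local.
End Depth.

(** * Filtrations and uniform annihilators of Tor *)

Section Filtrations.
Variable R : comNzRingType.
Implicit Types (I J K L P Q Y : set R) (a b r u v X : R) (s : seq R).
Implicit Types (G : nat -> set R) (n : nat).

Definition filtration Y G : Prop :=
  [/\ forall n, is_ideal (G n), G 0%N = [set: R], forall n, G n.+1 `<=` G n
    & forall n, Y `<=` G n].

(** Extending it by [X] gives [K + (X^n)] in degree [n]; with [K = Y] it stands for the powers of
    the zero ideal of [R/Y]. *)
Definition constant_filtration K n : set R := if n is _.+1 then K else [set: R].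

(** The sum of the [X^i G (n - i)] in Horner form. When [G] lists the powers of [I], it lists those
    of [I + (X)], see [ideal_pow_addi]. *)
Fixpoint ext G X n : set R :=
  if n is n'.+1 then [set u | exists v g, [/\ ext G X n' v, G n g & u = X * v + g]]
  else G 0%N.

(* [filt Y [:: X1; ...; Xs] n] is [(X1, ..., Xs)^n + Y], for [n > 0]. *)
Definition filt Y s : nat -> set R :=
  foldr (fun X G => ext G X) (constant_filtration Y) s.

Lemma is_ideal_ext G X : (forall n, is_ideal (G n)) -> forall n, is_ideal (ext G X n).
Proof.
move=> iG; elim=> [|n IHn] //=; split.
- exists 0, 0; split; [exact: is_ideal0|exact: is_ideal0|by rewrite mulr0 addr0].
- move=> _ _ [v [g [Hv Hg ->]]] [v' [g' [Hv' Hg' ->]]].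
  by exists (v + v'), (g + g'); split; [exact: is_idealD|exact: is_idealD|ring].
- move=> a _ [v [g [Hv Hg ->]]].
  by exists (a * v), (a * g); split; [exact: is_idealMl|exact: is_idealMl|ring].
Qed.

Lemma sub_ext G X : (forall n, is_ideal (G n)) -> forall n, G n `<=` ext G X n.
Proof.
move=> iG [|n] //= g Hg; exists 0, g; split=> //; last by rewrite mulr0 add0r.
by apply: is_ideal0; exact: is_ideal_ext.
Qed.

Lemma filtration_constant Y K : is_ideal K -> Y `<=` K ->
  filtration Y (constant_filtration K).
Proof. by move=> iK YK; split=> // -[|n] //; exact: is_idealT. Qed.

Lemma filtration_ext Y G X : filtration Y G -> filtration Y (ext G X).
Proof.
move=> [iG G0 Gdec YG]; split=> //; first exact: is_ideal_ext.
  elim=> [|n IHn] u; first by rewrite /= G0.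
  move=> [v [g [Hv Hg ->]]]; exists v, g; split; [exact: IHn|exact: Gdec|by []].
by move=> n; apply: subset_trans (YG n) _; exact: sub_ext.
Qed.

Lemma filtration_filt Y s : is_ideal Y -> filtration Y (filt Y s).
Proof.
move=> iY; elim: s => [|X s IHs]; first exact: filtration_constant.
exact: filtration_ext.
Qed.

Lemma ext_addi G X a n : ext (fun k => addi (G k) a) X n = addi (ext G X n) a.
Proof.
elim: n => //= n IHn; apply/seteqP; split=> u.
  move=> [v [g []]]; rewrite IHn => -[v' Hv' [r ->]] [g' Hg' [r' ->]] ->.
  exists (X * v' + g'); first by exists v', g'.
  by exists (X * r + r'); ring.
move=> [_ [v [g [Hv Hg ->]]] [r ->]]; exists v, (g + r * a); split.
- by rewrite IHn; exact: sub_addi.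
- by exists g => //; exists r.
- by rewrite addrA.
Qed.

Lemma filt_addi Y s a n : filt (addi Y a) s n = addi (filt Y s n) a.
Proof.
suff -> : filt (addi Y a) s = fun n => addi (filt Y s n) a by [].
elim: s => [|X s IHs] /=; last by rewrite IHs; apply/funext => k; exact: ext_addi.
apply/funext => -[|k] //=; apply/seteqP; split=> // u _.
by exists u => //; exists 0; rewrite mul0r addr0.
Qed.

Definition mul_mod Y K L : set R := ideal_span ([set a * b | a in K & b in L] `|` Y).

Lemma mul_mod_sub Y K L J : is_ideal J -> (forall a b, K a -> L b -> J (a * b)) ->
  Y `<=` J -> mul_mod Y K L `<=` J.
Proof.
by move=> iJ KLJ YJ; apply: ideal_span_sub => // _ [[a Ka [b Lb <-]]|/YJ//]; exact: KLJ.
Qed.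

Lemma mul_modM Y K L a b : K a -> L b -> mul_mod Y K L (a * b).
Proof. by move=> Ka Lb; apply: ideal_span_gen; left; exists a => //; exists b. Qed.

Lemma sub_mul_mod Y K L : Y `<=` mul_mod Y K L.
Proof. by move=> y Yy; apply: ideal_span_gen; right. Qed.

Lemma is_ideal_mul_mod Y K L : is_ideal (mul_mod Y K L).
Proof. exact: is_ideal_span. Qed.

Lemma mul_mod_addi Y K L e u : is_ideal K -> mul_mod Y K (addi L e) u ->
  exists w k, [/\ mul_mod Y K L w, K k & u = w + e * k].
Proof.
move=> iK; have iKL := is_ideal_mul_mod Y K L.
apply: (mul_mod_sub (J := [set u | exists w k, [/\ mul_mod Y K L w, K k & u = w + e * k]])).
- split.
  + by exists 0, 0; split; [exact: (is_ideal0 iKL)|exact: is_ideal0|rewrite mulr0 addr0].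
  + move=> _ _ [w [k [Hw Hk ->]]] [w' [k' [Hw' Hk' ->]]].
    by exists (w + w'), (k + k'); split; [exact: (is_idealD iKL)|exact: is_idealD|ring].
  + move=> a _ [w [k [Hw Hk ->]]].
    by exists (a * w), (a * k); split; [exact: (is_idealMl _ iKL)|exact: is_idealMl|ring].
- move=> a _ Ka [l Ll [r ->]]; exists (a * l), (r * a); split.
  + exact: mul_modM.
  + exact: is_idealMl.
  + ring.
- move=> y Yy; exists y, 0; split; [exact: sub_mul_mod|exact: is_ideal0|].
  by rewrite mulr0 addr0.
Qed.

(* [tor_killed Y K L c] says that [c] kills Tor_1(B/K, B/L) over [B = R/Y],
   this module being the quotient of the intersection of [K] and [L] by [KL]. *)
Definition tor_killed Y K L c : Prop :=
  forall l, K l -> L l -> mul_mod Y K L (c * l).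

(** Killers multiply along the Tor sequence of [0 -> R/(L : e) -> R/L -> R/(L + (e)) -> 0]. *)
Lemma tor_killed_addi Y K L e c1 c2 : is_ideal K -> is_ideal L -> Y `<=` L ->
  tor_killed Y K (colon L e) c1 -> tor_killed Y K (addi L e) c2 ->
  tor_killed Y K L (c1 * c2).
Proof.
move=> iK iL YL T1 T2 l Kl Ll; have iKL := is_ideal_mul_mod Y K L.
have [w [k [KLw Kk E]]] := mul_mod_addi iK (T2 l Kl (sub_addi _ Ll)).
have Lw : L w by apply: mul_mod_sub KLw => // a b _; exact: is_idealMl.
have Lk : colon L e k.
  rewrite /colon /=; have -> : k * e = c2 * l - w by rewrite E; ring.
  by apply: is_idealB => //; exact: is_idealMl.
have : colon (mul_mod Y K L) e (c1 * k).
  apply: mul_mod_sub (T1 k Kk Lk); first exact: is_ideal_colon.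
    by move=> a b Ka Lb; rewrite /colon /= -mulrA; exact: mul_modM.
  by apply: subset_trans (sub_colon _ _) => //; exact: sub_mul_mod.
rewrite /colon /= => H; rewrite -mulrA E.
have -> : c1 * (w + e * k) = c1 * w + c1 * k * e by ring.
by apply: (is_idealD iKL) => //; exact: (is_idealMl _ iKL).
Qed.

(** * Adjoining one element: Tor against the prime [P = (Y : b)] *)

Section AssociatedStep.
Variables (Y P : set R) (b X c c' : R) (G : nat -> set R).
Hypotheses (iY : is_ideal Y) (PE : P = colon Y b) (GY : filtration Y G).
Hypothesis X_nzd : forall n, nzd (G n) X.
Hypothesis c_kill : forall n, tor_killed Y (G n) (addi Y b) c.
Hypothesis c'_kill : forall n, tor_killed Y (G n) P c'.

(* [v] is the carry from the degree above. Each carry is divided by [b] only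
   once, so a single factor [c] serves all degrees. *)
Lemma ext_split n l v : ext G X n l -> G n v -> Y (b * (c * l - v)) -> G n (b * l) ->
  ext (fun k => G k `&` P) X n (c * l - v).
Proof.
have [iG G0 Gdec YG] := GY.
elim: n l v => [|n IHn] l v /=.
  by move=> _ _ Yblv _; split; rewrite ?G0 // PE /colon /= mulrC.
move=> [l1 [k0 [Gl1 Gk0 El]]] Gv Yblv Gbl.
have Gbl1 : G n.+1 (b * l1).
  apply: X_nzd; rewrite /colon /=.
  have -> : b * l1 * X = b * l - b * k0 by rewrite El; ring.
  by apply: is_idealB => //; exact: is_idealMl.
(* Killing Tor against [Y + (b)] amounts to a division by [b]: modulo [Y], [c * (b * l1)] is
   [b * v1] with [v1] in [G n.+1], and [v1] is the next carry. *)
have [|w [v1 [Yw Gv1 Ecbl1]]] := mul_mod_addi (iG n.+1) (c_kill Gbl1 _).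
  by rewrite mulrC; apply: is_idealMl; [exact: is_ideal_addi|exact: addi_gen].
have {}Yw : Y w by apply: mul_mod_sub Yw => // a y _; exact: is_idealMl.
have Ybl1 : Y (b * (c * l1 - v1)).
  by have -> : b * (c * l1 - v1) = w by [have := Ecbl1 => H; rewrite mulrBr mulrCA H addrK].
have := IHn l1 v1 Gl1 (Gdec _ _ Gv1) Ybl1 (Gdec _ _ Gbl1).
exists (c * l1 - v1), (X * v1 + c * k0 - v); split=> //; last by rewrite El; ring.
split.
  by apply: is_idealB => //; apply: is_idealD => //; exact: is_idealMl.
rewrite PE /colon /=.
have -> : (X * v1 + c * k0 - v) * b = b * (c * l - v) - X * (b * (c * l1 - v1)).
  by rewrite El; ring.
by apply: is_idealB => //; exact: is_idealMl.
Qed.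

(** Each coefficient of [h] as a polynomial in [X] lies in some [G k] and in [P], so [c'] can be
    applied coefficient by coefficient. *)
Lemma ext_prime_killed n h : ext (fun k => G k `&` P) X n h ->
  mul_mod Y (ext G X n) P (c' * h).
Proof.
have [iG G0 Gdec YG] := GY; have iM n' := is_ideal_mul_mod Y (ext G X n') P.
elim: n h => [|n IHn] h; first by move=> [Gh Ph]; exact: c'_kill.
move=> [h1 [k [Hh1 [Gk Pk] ->]]]; rewrite mulrDr; apply: (is_idealD (iM n.+1)).
  have : colon (mul_mod Y (ext G X n.+1) P) X (c' * h1).
    apply: mul_mod_sub (IHn _ Hh1); first exact: is_ideal_colon.
      move=> a p Ga Pp; rewrite /colon /=.
      have -> : a * p * X = X * a * p by ring.
      apply: mul_modM => //; exists a, 0; rewrite addr0; split=> //.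
      exact: is_ideal0.
    by apply: subset_trans (sub_colon _ _) => //; exact: sub_mul_mod.
  by rewrite /colon /= mulrAC mulrA.
apply: mul_mod_sub (c'_kill Gk Pk) => //; last exact: sub_mul_mod.
by move=> a p Ga Pp; apply: mul_modM => //; exact: sub_ext.
Qed.

(** The factor [c] brings the coefficients into [P], and [c'] then kills. The first carry is 0,
    since [b * l] is in [Y] for [l] in [P]. *)
Lemma tor_killed_ext n : tor_killed Y (ext G X n) P (c' * c).
Proof.
have [iG G0 Gdec YG] := GY.
move=> l Gl Pl; rewrite -mulrA; apply: ext_prime_killed.
rewrite -[c * l]subr0; apply: ext_split => //.
- exact: is_ideal0.
- by move: Pl; rewrite PE /colon /= subr0 mulrCA [b * l]mulrC => H; exact: is_idealMl.
- by apply: YG; move: Pl; rewrite PE /colon /= mulrC.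
Qed.

End AssociatedStep.

(** * Uniform killers outside a minimal prime of [Y] *)

Section MinimalPrime.
Hypothesis noethR : noetherian R.
Variables (Y P : set R).
Hypotheses (iY : is_ideal Y) (YP : assoc Y P).
Hypothesis P_min : forall Q, is_prime Q -> Y `<=` Q -> Q `<=` P -> Q = P.

(** The order of the quantifiers matters: [c] may depend on [L], but not on the filtration or the
    degree. *)
Definition uniformly_killed (Fam : set (nat -> set R)) : Prop :=
  forall L, is_ideal L -> Y `<=` L ->
  exists2 c, ~ P c & forall G n, Fam G -> tor_killed Y (G n) L c.

Lemma not_primeM c c' : ~ P c -> ~ P c' -> ~ P (c * c').
Proof. by case: YP => -[_ _ PM] _ nc nc' /PM[]. Qed.

Lemma not_prime1 : ~ P 1. Proof. by case: YP => -[]. Qed.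

(** Noetherian induction on [L], splitting off an associated prime [Q = (L : e)]. If [Q] is not
    inside [P], an element of [Q] outside [P] kills Tor against [Q]; otherwise [Q = P] by
    minimality, the case of [tor_killed_ext]. *)
Lemma uniformly_killed_ext (Fam : set (nat -> set R)) :
  Fam `<=` filtration Y -> uniformly_killed Fam ->
  uniformly_killed [set G' | exists G X, [/\ Fam G, forall n, nzd (G n) X & G' = ext G X]].
Proof.
move=> FamY killF.
have [c nPc c_kill] : exists2 c, ~ P c & forall G X n, Fam G -> (forall n, nzd (G n) X) ->
    tor_killed Y (ext G X n) P c.
  have [_ [b PE]] := YP; have iP : is_ideal P by case: YP => -[].
  have [||c nPc cP] := killF (addi Y b); [exact: is_ideal_addi|exact: sub_addi|].
  have [|c' nPc' c'P] := killF P iP; first exact: assoc_sub.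
  exists (c' * c) => [|G X n FG GX]; first exact: not_primeM.
  by apply: (@tor_killed_ext Y P b) => //; [exact: FamY|move=> k; exact: cP|move=> k; exact: c'P].
apply: noeth_ind => // L iL IH YL.
have iGX G X n : Fam G -> is_ideal (ext G X n).
  by move=> /FamY[iG _ _ _]; exact: is_ideal_ext.
have [L1|nL1] := pselect (L 1).
  exists 1 => [|_ n [G [X [FG GX ->]]] l Gl _]; first exact: not_prime1.
  by rewrite mul1r -[l]mulr1; exact: mul_modM.
have [Q QL _] := assoc_zero_divisor noethR iL nL1; have [[iQ Q1 QM] [e Qe]] := QL.
have [|||c2 nPc2 c2P] := IH (addi L e); first exact: is_ideal_addi.
- split; first exact: sub_addi.
  by move=> /(_ _ (addi_gen e iL)) Le; apply: Q1; rewrite Qe /colon /= mul1r.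
- exact: subset_trans YL (@sub_addi _ _ _).
have [c1 nPc1 c1P] : exists2 c1, ~ P c1 & forall G X n, Fam G -> (forall n, nzd (G n) X) ->
    tor_killed Y (ext G X n) Q c1.
  have [QP|/existsNP[t /not_implyP[Qt nPt]]] := pselect (Q `<=` P).
    suff -> : Q = P by exists c.
    exact: (P_min QL.1 (subset_trans YL (assoc_sub iL QL))).
  exists t => // G X n FG _ l Gl Ql.
  by rewrite mulrC; exact: mul_modM.
exists (c1 * c2) => [|G' n [G [X [FG GX ->]]]]; first exact: not_primeM.
apply: (@tor_killed_addi _ _ _ e) => //; first exact: iGX.
  by rewrite -Qe; exact: c1P.
by apply: c2P; exists G, X.
Qed.

(** Freezing one ideal [G n] allows [uniformly_killed_ext] to adjoin [X] to that ideal alone: degree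
    1 of the extension is [G n + (X)]. *)
Lemma uniformly_killed_constant (Fam : set (nat -> set R)) :
  uniformly_killed Fam ->
  uniformly_killed [set G' | exists G n, Fam G /\ G' = constant_filtration (G n)].
Proof.
move=> killF L iL YL; have [c nPc cP] := killF L iL YL.
exists c => // G' [|j] [G [n [FG ->]]]; last exact: (cP G n).
by move=> l _ Ll; exact: mul_modM.
Qed.

Fixpoint nzd_filt s : Prop :=
  if s is X :: s' then nzd_filt s' /\ forall n, nzd (filt Y s' n) X else True.

Lemma uniformly_killed_filt k :
  uniformly_killed [set G | exists s, [/\ size s = k, nzd_filt s & G = filt Y s]].
Proof.
elim: k => [|k IHk].
  move=> L iL YL; exists 1; first exact: not_prime1.
  move=> G [|n] [s [/size0nil -> _ ->]] l Gl Ll; first exact: mul_modM.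
  by rewrite mul1r; exact: sub_mul_mod.
move=> L iL YL; have [|c nPc cP] := uniformly_killed_ext _ IHk iL YL.
  by move=> G [s [_ _ ->]]; exact: filtration_filt.
exists c => // G' n [[|X s] [//= [sz] [ns Xs] ->]].
by apply: cP; exists (filt Y s), X; split=> //; exists s.
Qed.

Definition sum_ideal K L : set R := [set u | exists k l, [/\ K k, L l & u = k + l]].

(** With [K = filt Y s n], a relation [w X = g + l] puts [l] in both [K + (X)] and [L]. Killing Tor
    gives [c l = g' + X l'] with [g'] in [K] and [l'] in [L], so [X (c w - l')] is in [K], and [X]
    cancels modulo [K]. *)
Lemma colon_killer k L : is_ideal L -> Y `<=` L ->
  exists2 c, ~ P c & forall s X, size s = k -> nzd_filt (X :: s) ->
    forall n w, sum_ideal (filt Y s n) L (w * X) -> sum_ideal (filt Y s n) L (c * w).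
Proof.
move=> iL YL.
have kill := uniformly_killed_ext _ (uniformly_killed_constant (@uniformly_killed_filt k)).
have [|c nPc cP] := kill _ L iL YL.
  move=> G' [_ [n [[s [_ _ ->]] ->]]].
  by have [iG _ _ YG] := filtration_filt s iY; exact: filtration_constant.
exists c => // s X szs [ns Xs] n w [g [l [Gg Ll E]]].
have [iG _ _ YG] := filtration_filt s iY.
have [g' [l' [Gg' Ll' E']]] : exists g l', [/\ filt Y s n g, L l' & c * l = g + X * l'].
  have : mul_mod Y (ext (constant_filtration (filt Y s n)) X 1) L (c * l).
    apply: cP => //.
      exists (constant_filtration (filt Y s n)), X; split=> //; last by move=> [|j] //; exact: Xs.
      by exists (filt Y s), n; split=> //; exists s.
    exists w, (- g); split=> //; first exact: is_idealN (iG n) Gg.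
    by rewrite [X * w]mulrC E; ring.
  apply: (mul_mod_sub (J := [set u | exists g l1, [/\ filt Y s n g, L l1 & u = g + X * l1]])).
  - split.
    + by exists 0, 0; split; [exact: is_ideal0|exact: is_ideal0|rewrite mulr0 addr0].
    + move=> _ _ [v [k' [Hv Hk ->]]] [v' [k'' [Hv' Hk' ->]]].
      by exists (v + v'), (k' + k''); split; [exact: is_idealD|exact: is_idealD|ring].
    + move=> a _ [v [k' [Hv Hk ->]]].
      by exists (a * v), (a * k'); split; [exact: is_idealMl|exact: is_idealMl|ring].
  - move=> _ b [v [h [_ Hh ->]]] Lb; exists (h * b), (v * b); split=> /=.
    + exact: is_idealMr.
    + exact: is_idealMl.
    + by ring.
  - move=> y Yy; exists y, 0; split; [exact: YG|exact: is_ideal0|by rewrite mulr0 addr0].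
have : colon (filt Y s n) X (c * w - l').
  rewrite /colon /=.
  have -> : (c * w - l') * X = c * (w * X) - X * l' by ring.
  rewrite E mulrDr E' addrA addrK.
  by apply: is_idealD => //; exact: is_idealMl.
by move/Xs => H; exists (c * w - l'), l'; split=> //; rewrite subrK.
Qed.

End MinimalPrime.
End Filtrations.

(** * Permuting regular sequences *)

Section RegularPermutation.
Variable R : comNzRingType.
Implicit Types (I J K L P Q Y : set R) (a b r u v X : R) (s : seq R) (n : nat).
Variable m : set R.
Hypotheses (noethR : noetherian R) (m_ideal : is_ideal m).
Hypotheses (m_max : forall I, is_ideal I -> ~ I 1 -> I `<=` m) (m1 : ~ m 1).

Lemma reg_swap I a b s : is_ideal I -> m a -> reg I [:: a, b & s] -> reg I [:: b, a & s].
Proof.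
move=> iI ma /= [Ia [Iab Iabs]]; split; last split.
- exact: nzd_addi_drop ma Ia Iab.
- exact: nzd_addi_swap.
- by rewrite addiC.
Qed.

Lemma reg_move I s1 a s2 : is_ideal I -> (forall b, b \in s1 -> m b) ->
  reg I (s1 ++ a :: s2) -> reg I (a :: s1 ++ s2).
Proof.
elim: s1 I => // b s1 IHs I iI ms [Ib regs]; apply: reg_swap => //.
  by apply: ms; exact: mem_head.
split=> //; apply: IHs => //; first exact: is_ideal_addi.
by move=> c sc; apply: ms; rewrite in_cons sc orbT.
Qed.

Lemma reg_perm I s t : is_ideal I -> (forall b, b \in s -> m b) -> perm_eq s t ->
  reg I s -> reg I t.
Proof.
elim: t I s => // b t IHt I s iI ms st regs.
have sb : b \in s by rewrite (perm_mem st) mem_head.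
move: sb ms st regs => /path.splitPr[s1 s2] ms st regs.
have [|Ib regs'] := reg_move iI _ regs.
  by move=> c sc; apply: ms; rewrite mem_cat sc.
split=> //; apply: IHt regs'; first exact: is_ideal_addi.
  by move=> c; rewrite mem_cat => sc; apply: ms; rewrite mem_cat in_cons orbCA sc orbT.
by move: st; rewrite -cat1s perm_catCA /= perm_cons.
Qed.

Lemma reg_catl I s t : reg I (s ++ t) -> reg I s.
Proof. by elim: s I => //= a s IHs I [Ia /IHs]. Qed.

Lemma reg_rconsX I s a n : reg I (rcons s a) -> reg I (rcons s (a ^+ n)).
Proof.
elim: s I => [|b s IHs] I /= [Ia regs]; first by split=> //; exact: nzdX.
by split=> //; exact: IHs.
Qed.

(** The last element of a regular sequence may be replaced by a power; permuting brings every
    element to the last place in turn. *)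
Lemma reg_map_exp I s n : is_ideal I -> (0 < n)%N -> (forall b, b \in s -> m b) ->
  reg I s -> reg I [seq b ^+ n | b <- s].
Proof.
elim: s I => // a s IHs I iI n0 ms regs.
have ma : m a by apply: ms; exact: mem_head.
have ms' b : b \in s -> m b by move=> sb; apply: ms; rewrite in_cons sb orbT.
have /reg_rconsX -/(_ n) regsa : reg I (rcons s a).
  by apply: reg_perm regs => //; rewrite perm_sym perm_rcons.
have [Ia regs'] : reg I (a ^+ n :: s).
  apply: reg_perm regsa => //; last by rewrite perm_rcons.
  by move=> b; rewrite mem_rcons in_cons => /predU1P[->|/ms'//]; exact: is_idealX.
by split=> //; apply: IHs => //; exact: is_ideal_addi.
Qed.

(** Write [u X = Z t + g]. The shorter list over [Y + (Z)] gives [u = g' + u' Z] with [g'] in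
    [filt Y s n.+1]. Cancelling [Z] modulo that ideal puts [u' X] in the extension in degree [n],
    where induction on [n] applies to [u']. *)
Lemma nzd_filt_reg Y s X : is_ideal Y -> (forall b, b \in X :: s -> m b) ->
  reg Y (X :: s) -> forall n, nzd (filt Y s n) X.
Proof.
elim: s Y X => [|Z s IHs] Y X iY ms regs; first by case=> // n; case: regs.
have mX : m X by apply: ms; exact: mem_head.
have mZ : m Z by apply: ms; rewrite !in_cons eqxx orbT.
have msX b : b \in X :: s -> m b.
  by rewrite in_cons => /orP[|] H; apply: ms; rewrite !in_cons H ?orbT.
have msZ b : b \in Z :: s -> m b by move=> H; apply: ms; rewrite in_cons H orbT.
have [_ regX] := reg_swap iY mX regs.
have regZ : reg Y (Z :: s).
  apply: (@reg_catl _ _ [:: X]); apply: reg_perm regs => //.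
  by rewrite perm_sym cats1 perm_rcons.
have nzdZ n := IHs Y Z iY msZ regZ n.
have nzdX n := IHs _ X (is_ideal_addi Z iY) msX regX n.
have [iG G0 Gdec YG] := filtration_filt s iY.
have iG' := is_ideal_ext Z iG.
have filt0 : filt Y (Z :: s) 0 = [set: R] by [].
elim=> [|n IHn] u; first by rewrite filt0.
rewrite /colon /= => -[t [g [Gt Gg E]]].
have : addi (filt Y s n.+1) Z u.
  rewrite -filt_addi; apply: nzdX; rewrite /colon /= filt_addi.
  by exists g => //; exists t; rewrite E; ring.
move=> [g' Gg' [u' Eu]].
have : colon (filt Y s n.+1) Z (u' * X - t).
  rewrite /colon /=.
  have -> : (u' * X - t) * Z = u * X - Z * t - g' * X by rewrite Eu; ring.
  rewrite E [Z * t + g]addrC addrK; apply: is_idealB => //; exact: is_idealMr.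
move=> /nzdZ H; have : ext (filt Y s) Z n (u' * X).
  rewrite -[u' * X](subrK t); apply: is_idealD => //.
  by apply: sub_ext => //; exact: Gdec.
by move=> /IHn Hu'; exists u', g'; split=> //; rewrite Eu; ring.
Qed.

Lemma reg_nzd_filt Y s : is_ideal Y -> (forall b, b \in s -> m b) -> reg Y s -> nzd_filt Y s.
Proof.
elim: s Y => // X s IHs Y iY ms regs; split; last exact: nzd_filt_reg.
have ms' b : b \in s -> m b by move=> H; apply: ms; rewrite in_cons H orbT.
apply: IHs => //; apply: (@reg_catl _ _ [:: X]); apply: reg_perm regs => //.
by rewrite perm_sym cats1 perm_rcons.
Qed.

End RegularPermutation.

(** * Minimal primes, ideal powers and Rees algebras *)

Section PrimeIdealr.
Variable R : comNzRingType.
Implicit Types (I P : set R).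

Lemma is_ideal_idealr (Q : idealr R) : is_ideal [set` Q].
Proof. by split=> [|a b|a b] /=; [exact: rpred0|exact: rpredD|exact: idealMr]. Qed.

Lemma idealrP I : is_ideal I -> ~ I 1 -> exists Q : idealr R, [set` Q] = I.
Proof.
move=> iI I1; pose p x := `[< I x >].
have pC : idealr_closed p.
  split; [by apply/asboolP; exact: is_ideal0|exact/asboolP|move=> a u v /asboolP Iu /asboolP Iv].
  by apply/asboolP; apply: is_idealD => //; exact: is_idealMl.
pose Q : idealr R := HB.pack p (isIdealr.Build R p pC).
by exists Q; apply/seteqP; split=> u /=; move/asboolP.
Qed.

Lemma is_prime_idealr (Q : prime_idealr R) : is_prime [set` Q].
Proof.
split; [exact: is_ideal_idealr|by rewrite /= idealr1|].
by move=> a b /=; rewrite prime_idealrM => /orP.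
Qed.

Lemma prime_idealrP P : is_prime P -> exists Q : prime_idealr R, [set` Q] = P.
Proof.
move=> [iP P1 PM]; pose p x := `[< P x >].
have pC : idealr_closed p.
  split; [by apply/asboolP; exact: is_ideal0|exact/asboolP|move=> a u v /asboolP Iu /asboolP Iv].
  by apply/asboolP; apply: is_idealD => //; exact: is_idealMl.
have pP : prime_idealr_closed p.
  by move=> u v /asboolP/PM[] H; apply/orP; [left|right]; exact/asboolP.
pose Q : prime_idealr R := HB.pack p (isIdealr.Build R p pC) (isPrimeIdealrClosed.Build R p pP).
by exists Q; apply/seteqP; split=> u /=; move/asboolP.
Qed.

Lemma minimal_primeP (P : prime_idealr R) :
  minimal_prime P <-> forall Q, is_prime Q -> Q `<=` [set` P] -> Q = [set` P].
Proof.
split=> [Pmin Q /prime_idealrP[Q' <-]|Pmin Q QP]; first exact: Pmin.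
by apply: Pmin => //; exact: is_prime_idealr.
Qed.

Lemma seq_minimal (Qs : seq (set R)) Q : Q \in Qs ->
  exists2 P, P \in Qs & P `<=` Q /\ forall Q', Q' \in Qs -> Q' `<=` P -> Q' = P.
Proof.
have [n] := ubnP (size Qs); elim: n Qs Q => // n IHn Qs Q szQs QQs.
have [[Q1 [Q1Qs Q1Q nQQ1]]|nQ1] :=
    pselect (exists Q', [/\ Q' \in Qs, Q' `<=` Q & ~ (Q `<=` Q')]); last first.
  exists Q => //; split=> // Q' Q'Qs Q'Q; apply/seteqP; split=> //.
  by apply: contrapT => nQQ'; apply: nQ1; exists Q'.
pose Qs' := [seq Q' <- Qs | `[< Q' `<=` Q1 >]].
have sz : (size Qs' < n)%N.
  move: szQs; rewrite ltnS; apply: leq_trans.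
  rewrite size_filter -(count_predC (fun Q' => `[< Q' `<=` Q1 >])).
  rewrite -[X in (X < _)%N]addn0 ltn_add2l -has_count.
  by apply/hasP; exists Q => //=; apply/asboolP.
have [|P + [PQ1 Pmin]] := IHn Qs' Q1 sz.
  by rewrite mem_filter Q1Qs andbT; apply/asboolP.
rewrite mem_filter => /andP[_ PQs]; exists P => //; split; first exact: subset_trans Q1Q.
move=> Q' Q'Qs Q'P; apply: Pmin => //; rewrite mem_filter Q'Qs andbT.
by apply/asboolP; exact: subset_trans PQ1.
Qed.

Hypothesis noethR : noetherian R.

(** Every prime contains one of the finitely many associated primes of 0, so the minimal ones among
    these are the minimal primes. *)
Lemma minimal_prime_below Q : is_prime Q ->
  exists2 P : prime_idealr R, minimal_prime P & [set` P] `<=` Q.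
Proof.
move=> QP; have i0 := is_ideal_zero R.
have below (Q' : set R) : is_prime Q' -> exists2 P, assoc [set 0] P & P `<=` Q'.
  move=> Q'P; have [iQ' _ _] := Q'P.
    by apply: (assoc_below noethR i0 Q'P) => _ ->; exact: is_ideal0.
have [Qs QsP] := assoc_finite noethR i0.
have [Q1 /QsP Q1Qs Q1Q] := below Q QP.
have [P /QsP PP [PQ1 Pmin]] := seq_minimal Q1Qs.
have [P' P'E] := prime_idealrP PP.1.
exists P'; last by rewrite P'E; exact: subset_trans Q1Q.
apply/minimal_primeP; rewrite P'E => Q2 /below[Q3 Q3P Q32] Q2P.
have E : Q3 = P by apply: Pmin; [exact/QsP|exact: subset_trans Q2P].
by apply/seteqP; split=> //; rewrite -E.
Qed.

Lemma nilpotent_of_minimal_primes w :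
  (forall P : prime_idealr R, minimal_prime P -> w \in P) -> exists e, w ^+ e = 0.
Proof.
move=> wP; apply: contrapT => nw.
(* An ideal maximal among those containing no power of [w] is prime; the minimal prime below it
   would contain [w]. *)
have [||Q [[iQ Qw] _ maxQ]] := @noeth_max R noethR
    [set J | is_ideal J /\ forall e, ~ J (w ^+ e)] [set 0].
- by move=> J [].
- split; first exact: is_ideal_zero.
  by move=> e we; apply: nw; exists e.
have big a : ~ Q a -> exists e, addi Q a (w ^+ e).
  move=> nQa; apply: contrapT => nwe; apply: nQa; rewrite -(maxQ (addi Q a)).
  - exact: addi_gen.
  - by split=> [|e we]; [exact: is_ideal_addi|apply: nwe; exists e].
  - exact: sub_addi.
have Qprime : is_prime Q.
  split=> // [Q1|a b Qab]; first by apply: (Qw 0%N); rewrite expr0.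
  apply: contrapT => /not_orP[/big[e [i Qi [r Ei]]] /big[e' [j Qj [q Ej]]]].
  apply: (Qw (e + e')%N); rewrite exprD Ei Ej.
  have -> : (i + r * a) * (j + q * b) = i * (j + q * b) + (r * a * j + r * q * (a * b)).
    by ring.
  apply: is_idealD => //; first exact: is_idealMr.
  by apply: is_idealD => //; exact: is_idealMl.
have [P Pmin PQ] := minimal_prime_below Qprime.
by apply: (Qw 1%N); rewrite expr1; apply: PQ => /=; exact: wP.
Qed.

End PrimeIdealr.

Section IdealPowers.
Variable R : comNzRingType.
Implicit Types (I J K L : set R) (a b z : R) (n : nat).

Lemma is_ideal_mul I J : is_ideal (ideal_mul I J). Proof. exact: is_ideal_span. Qed.

Lemma ideal_mulM I J a b : I a -> J b -> ideal_mul I J (a * b).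
Proof. by move=> Ia Jb; apply: ideal_span_gen; exists a => //; exists b. Qed.

Lemma ideal_mul_sub I J K : is_ideal K -> (forall a b, I a -> J b -> K (a * b)) ->
  ideal_mul I J `<=` K.
Proof. by move=> iK H; apply: ideal_span_sub => // _ [a Ia [b Jb <-]]; exact: H. Qed.

Lemma ideal_mulS I I' J J' : I `<=` I' -> J `<=` J' -> ideal_mul I J `<=` ideal_mul I' J'.
Proof.
move=> II' JJ'; apply: ideal_mul_sub; first exact: is_ideal_mul.
by move=> a b Ia Jb; apply: ideal_mulM; [exact: II'|exact: JJ'].
Qed.

Lemma is_ideal_pow I n : is_ideal (ideal_pow I n).
Proof. by case: n => [|n]; [exact: is_idealT|exact: is_ideal_mul]. Qed.

Lemma ideal_powS I J n : I `<=` J -> ideal_pow I n `<=` ideal_pow J n.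
Proof. by move=> IJ; elim: n => // n IHn; exact: ideal_mulS. Qed.

Lemma ideal_powM I n k a b : ideal_pow I n a -> ideal_pow I k b ->
  ideal_pow I (n + k) (a * b).
Proof.
elim: n a => [|n IHn] a; first by move=> _ Ib; apply: is_idealMl => //; exact: is_ideal_pow.
move=> + Ib; suff : ideal_pow I n.+1 `<=` colon (ideal_pow I (n.+1 + k)) b by apply.
apply: ideal_mul_sub; first exact/is_ideal_colon/is_ideal_pow.
move=> c d Ic Id; rewrite /colon /= -mulrA; apply: ideal_mulM => //.
exact: IHn.
Qed.

Lemma ideal_pow_le I n k : (n <= k)%N -> ideal_pow I k `<=` ideal_pow I n.
Proof.
move=> /subnK <-; elim: (k - n)%N => // j IHj; apply: subset_trans IHj.
apply: ideal_mul_sub; first exact: is_ideal_pow.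
by move=> a b _; apply: is_idealMl; exact: is_ideal_pow.
Qed.

Lemma ideal_pow1 I : is_ideal I -> ideal_pow I 1 = I.
Proof.
move=> iI; apply/seteqP; split; first by apply: ideal_mul_sub => // a b Ia _; exact: is_idealMr.
by move=> a Ia; rewrite -[a]mulr1; exact: ideal_mulM.
Qed.

Lemma ideal_powD I n k : ideal_pow I (n + k) = ideal_mul (ideal_pow I n) (ideal_pow I k).
Proof.
apply/seteqP; split; last first.
  by apply: ideal_mul_sub; [exact: is_ideal_pow|exact: ideal_powM].
elim: n => [|n IHn] a; first by move=> Ia; rewrite -[a]mul1r; exact: ideal_mulM.
rewrite addSn; apply: ideal_mul_sub; first exact: is_ideal_mul.
move=> b c Ib /IHn Ic.
suff : ideal_mul (ideal_pow I n) (ideal_pow I k) `<=`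
    colon (ideal_mul (ideal_pow I n.+1) (ideal_pow I k)) b.
  by move=> /(_ _ Ic); rewrite /colon /= mulrC.
apply: ideal_mul_sub; first exact/is_ideal_colon/is_ideal_mul.
move=> u v Iu Iv; rewrite /colon /=.
have -> : u * v * b = b * u * v by ring.
by apply: ideal_mulM => //; exact: ideal_mulM.
Qed.

Lemma ideal_pow_pow I n k : ideal_pow (ideal_pow I n) k = ideal_pow I (n * k).
Proof.
elim: k => [|k IHk]; first by rewrite muln0.
by rewrite mulnS ideal_powD -IHk.
Qed.

Lemma ext_ideal_powM I X n i v : is_ideal I -> I i -> ext (ideal_pow I) X n v ->
  ext (ideal_pow I) X n.+1 (i * v).
Proof.
move=> iI Ii; elim: n v => [|n IHn] v.
  move=> _; exists 0, (i * v); split=> //; last by rewrite mulr0 add0r.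
  exact: ideal_mulM.
move=> [v' [g [/IHn Hv Hg ->]]]; exists (i * v'), (i * g); split=> //; last by ring.
exact: ideal_mulM.
Qed.

Lemma ideal_pow_addi I X n : is_ideal I -> ideal_pow (addi I X) n = ext (ideal_pow I) X n.
Proof.
move=> iI; have iK := is_ideal_addi X iI; have iE := is_ideal_ext X (is_ideal_pow I).
elim: n => // n IHn; apply/seteqP; split; last first.
  move=> _ [v [g [Hv Hg ->]]]; apply: (is_idealD (is_ideal_pow (addi I X) n.+1)).
    have Kv : ideal_pow (addi I X) n v by rewrite IHn.
    exact: (ideal_mulM (addi_gen X iI) Kv).
  by apply: ideal_powS Hg; exact: sub_addi.
apply: (ideal_mul_sub (iE n.+1)) => _ b [i Ii [r ->]].
move=> Kb; have Eb : ext (ideal_pow I) X n b by rewrite -IHn.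
have Eib := ext_ideal_powM iI Ii Eb.
rewrite mulrDl; apply: (is_idealD (iE n.+1)) => //.
exists (r * b), 0; split; [exact: (is_idealMl _ (iE n))| |by ring].
by apply: is_ideal0; exact: is_ideal_pow.
Qed.

Lemma filt_zero s n : filt [set (0 : R)] s n = ideal_pow (ideal_of s) n.
Proof.
suff -> : filt [set (0 : R)] s = ideal_pow (ideal_of s) by [].
elim: s => [|X s IHs].
  apply/funext => -[|k] //; rewrite ideal_of_nil; apply/seteqP; split=> [_ ->|].
    by apply: is_ideal0; exact: is_ideal_pow.
  apply: ideal_mul_sub; first exact: is_ideal_zero.
  by move=> a b -> _; rewrite /= mul0r.
apply/funext => k; rewrite ideal_of_cons ideal_pow_addi ?IHs //.
  by rewrite -IHs.
exact: is_ideal_of.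
Qed.

Lemma image_filt (A : comNzRingType) (f : {rmorphism A -> R}) (Y : set A) (s : seq A) n :
  range f = [set: R] -> is_ideal Y -> (forall y, Y y -> f y = 0) ->
  f @` filt Y s n = ideal_pow (ideal_of (map f s)) n.
Proof.
move=> fT iY fY; rewrite -filt_zero; have surj (u : R) : exists c, f c = u.
  have [c _ <-] : range f u by rewrite fT.
  by exists c.
elim: s n => [|X s IHs] n /=.
  case: n => [|n] /=; apply/seteqP; split=> // u; first by move=> _; have [c <-] := surj u; exists c.
    by move=> [y /fY -> <-].
  by move=> ->; exists 0; [exact: is_ideal0|exact: rmorph0].
elim: n => [|n IHn] //=.
apply/seteqP; split=> u.
  move=> [_ [v [g [Hv Hg ->]]] <-]; exists (f v), (f g); split.
  - by rewrite -IHn; exists v.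
  - by rewrite -IHs; exists g.
  - by rewrite rmorphD rmorphM.
move=> [v [g []]]; rewrite -IHn -IHs => -[v' Hv' <-] [g' Hg' <-] ->.
by exists (X * v' + g'); [exists v', g'|rewrite rmorphD rmorphM].
Qed.

End IdealPowers.

(** * Hilbert's basis theorem, then the Rees algebra *)

Section Hilbert.
Variable R : comNzRingType.

(** Choose [f n] of least degree in [I] outside the ideal of its predecessors. Some leading
    coefficient, that of [f N], is a combination of the earlier ones; as degrees do not decrease,
    shifting by powers of ['X] cancels the leading term of [f N], against the minimality of its
    degree. *)
Lemma hilbert_basis : noetherian R -> noetherian {poly R}.
Proof.
move=> noethR I iI; apply: contrapT => nfg.
have next (s : seq {poly R}) : exists f, (forall g, g \in s -> I g) ->
    [/\ I f, ~ ideal_of s f & forall g, I g -> ~ ideal_of s g -> (size f <= size g)%N].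
  have [sI|nsI] := pselect (forall g, g \in s -> I g); last by exists 0 => /nsI.
  have [f0 [If0 nf0]] : exists f, I f /\ ~ ideal_of s f.
    apply: contrapT => H; apply: nfg; exists s; apply/seteqP; split.
      by move=> f If; apply: contrapT => nf; apply: H; exists f.
    exact: ideal_of_sub.
  have ex : exists k, `[< exists f, [/\ I f, ~ ideal_of s f & size f = k] >].
    by exists (size f0); apply/asboolP; exists f0.
  have [_ /asboolP[f [If nf <-]] fmin] := ex_minnP ex.
  by exists f => _; split=> // g Ig ng; apply: fmin; apply/asboolP; exists g.
have [F FP] := choice next.
pose L n := iter n (fun s => rcons s (F s)) [::].
pose f n := F (L n).
have LE n : L n = mkseq f n.
  by elim: n => // n IHn; rewrite mkseqS -IHn.
have LI n g : g \in L n -> I g.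
  elim: n g => // n IHn g; rewrite /= mem_rcons in_cons => /predU1P[->|/IHn//].
  by have [] := FP _ IHn.
have {FP} fP n : [/\ I (f n), ~ ideal_of (mkseq f n) (f n)
    & forall g, I g -> ~ ideal_of (mkseq f n) g -> (size (f n) <= size g)%N].
  by rewrite -LE; apply: FP; exact: LI.
have f_neq0 n : (0 < size (f n))%N.
  rewrite size_poly_gt0; apply/eqP => E; have [_ + _] := fP n; apply.
  by rewrite E; apply: is_ideal0; exact: is_ideal_of.
have [N /ideal_of_mkseq[r rE]] := noeth_seq noethR (fun n => lead_coef (f n)).
have [IfN nfN fN_min] := fP N.
have size_le i : (i < N)%N -> (size (f i) <= size (f N))%N.
  move=> iN; have [_ _ fi_min] := fP i; apply: fi_min => // H; apply: nfN.
  apply: ideal_of_subset H => g /mapP[j]; rewrite mem_iota add0n => /andP[_ ji] ->.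
  by rewrite map_f // mem_iota add0n (ltn_trans ji).
pose h := \sum_(i < N) (r i *: 'X^(size (f N) - size (f i)) : {poly R}) * f i.
have hN : ideal_of (mkseq f N) h.
  apply: (is_ideal_sum _ (is_ideal_of (mkseq f N))).
  move=> i; apply: (is_idealMl _ (is_ideal_of (mkseq f N))).
  by apply: ideal_of_mem; rewrite map_f // mem_iota add0n /= ltn_ord.
have Ih : I h by apply: ideal_of_sub hN => // g; rewrite -LE; exact: LI.
have : (size (f N) <= size (f N - h)%R)%N.
  apply: fN_min; first exact: is_idealB.
  move=> H; apply: nfN; rewrite -[f N](subrK h).
  exact: (is_idealD (is_ideal_of (mkseq f N))).
apply/negP; rewrite -ltnNge -(prednK (f_neq0 N)) ltnS.
apply/leq_sizeP => j jN; rewrite coefB coef_sum.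
have coefE (i : 'I_N) : ((r i *: 'X^(size (f N) - size (f i)) * f i)`_j =
    if j == (size (f N)).-1 then r i * lead_coef (f i) else 0).
  have le_i := size_le i (ltn_ord i); have fi0 := f_neq0 i; have fN0 := f_neq0 N.
  rewrite -scalerAl coefZ coefXnM ltnNge.
  have -> /= : (size (f N) - size (f i) <= j)%N by lia.
  have [->|jN'] := eqVneq j (size (f N)).-1.
    have E (a b : nat) : (0 < a)%N -> (a <= b)%N -> (b.-1 - (b - a) = a.-1)%N by lia.
    by rewrite /lead_coef (E _ _ fi0 le_i).
  have E (a b : nat) : (0 < a)%N -> (a <= b)%N -> (b.-1 <= j)%N -> j != b.-1 ->
      (a <= j - (b - a))%N by lia.
  by rewrite nth_default ?mulr0 //; exact: E.
rewrite (eq_bigr _ (fun i _ => coefE i)).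
have [->|jN'] := eqVneq j (size (f N)).-1.
  by rewrite -rE /lead_coef subrr.
rewrite big1 ?subr0 // nth_default // -(prednK (f_neq0 N)).
by rewrite ltn_neqAle eq_sym jN'.
Qed.

End Hilbert.

Section Rees.
Variables (R : comNzRingType) (I : set R).
Hypotheses (noethR : noetherian R) (iI : is_ideal I).

Definition rees (p : {poly R}) : Prop := forall j, ideal_pow I j p`_j.

Lemma rees0 : rees 0.
Proof. by move=> j; rewrite coef0; apply: is_ideal0; exact: is_ideal_pow. Qed.

Lemma reesD p q : rees p -> rees q -> rees (p + q).
Proof. by move=> Hp Hq j; rewrite coefD; apply: is_idealD => //; exact: is_ideal_pow. Qed.

Lemma reesM p q : rees p -> rees q -> rees (p * q).
Proof.
move=> Hp Hq j; rewrite coefM; apply: is_ideal_sum; first exact: is_ideal_pow.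
move=> i; rewrite -[X in ideal_pow I X](subnKC (leq_ord i)).
exact: ideal_powM.
Qed.

Lemma reesMXn a n : ideal_pow I n a -> rees (a%:P * 'X^n).
Proof.
move=> Ia j; rewrite coefMXn coefC subn_eq0; case: ltngtP => [_|_|->] //=;
  by apply: is_ideal0; exact: is_ideal_pow.
Qed.

(** Instead of a ring structure on the Rees algebra itself, a noetherian ring mapping onto its
    homogeneous elements: an iterated polynomial ring over [R], with one variable sent to
    [g%:P * 'X] for each generator [g] of [I]. *)
Lemma rees_presentation : exists (N : comNzRingType) (phi : {rmorphism N -> {poly R}}),
  [/\ noetherian N, forall u, rees (phi u)
    & forall n a, ideal_pow I n a -> exists u, phi u = a%:P * 'X^n].
Proof.
have [s sE] := noethR iI.
suff [N [phi [noethN phiR phiC phis]]] : exists (N : comNzRingType)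
    (phi : {rmorphism N -> {poly R}}), [/\ noetherian N, forall u, rees (phi u),
    forall a, exists u, phi u = a%:P & forall a, a \in s -> exists u, phi u = a%:P * 'X].
  exists N, phi; split=> //.
  have phiI a : I a -> exists u, phi u = a%:P * 'X.
    rewrite sE; apply: (ideal_of_sub (J := [set a | exists u, phi u = a%:P * 'X])) => //.
    split=> [|b c [u Hu] [v Hv]|b c [v Hv]]; first by exists 0; rewrite rmorph0 mul0r.
      by exists (u + v); rewrite rmorphD Hu Hv polyCD mulrDl.
    by have [u Hu] := phiC b; exists (u * v); rewrite rmorphM Hu Hv polyCM mulrA.
  elim=> [|n IHn] a; first by move=> _; rewrite mulr1; exact: phiC.
  suff : ideal_pow I n.+1 `<=` [set c : R | exists u : N, phi u = c%:P * 'X^(n.+1) :> {poly R}] by exact.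
  apply: ideal_mul_sub.
    split=> [|b c [u Hu] [v Hv]|b c [v Hv]]; first by exists 0; rewrite rmorph0 mul0r.
      by exists (u + v); rewrite rmorphD Hu Hv polyCD mulrDl.
    by have [u Hu] := phiC b; exists (u * v); rewrite rmorphM Hu Hv polyCM mulrA.
  move=> b c /phiI[u Hu] /IHn[v Hv]; exists (u * v).
  by rewrite rmorphM Hu Hv polyCM exprS; ring.
have: forall a, a \in s -> I a by move=> a; rewrite sE; exact: ideal_of_mem.
elim: s {sE} => [_|g s IHs sI].
  exists R, polyC; split=> // [u j|a]; last by exists a.
  rewrite coefC; case: eqP => [->//|_]; apply: is_ideal0; exact: is_ideal_pow.
have [|N [phi [noethN phiR phiC phis]]] := IHs.
  by move=> a sa; apply: sI; rewrite in_cons sa orbT.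
pose gX := g%:P * 'X : {poly R}.
have cgX : commr_rmorph phi gX by move=> u; exact: mulrC.
exists {poly N}, (horner_morph cgX); split.
- exact: hilbert_basis.
- move=> p; suff : rees (map_poly phi p).[gX] by [].
  rewrite horner_coef.
  apply: big_ind; [exact: rees0|exact: reesD|move=> i _].
  apply: reesM; first by rewrite coef_map; exact: phiR.
  elim: (i : nat) => [|k IHk].
    have : rees (1%:P * 'X^0) by exact: reesMXn.
    by rewrite expr0 mulr1.
  rewrite exprS; apply: reesM => //; rewrite /gX -['X]expr1.
  by apply: reesMXn; rewrite ideal_pow1 //; apply: sI; exact: mem_head.
- by move=> a; have [u Hu] := phiC a; exists u%:P; exact: etrans (horner_morphC cgX u) Hu.
- move=> a; rewrite in_cons => /predU1P[->|/phis[u Hu]].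
    by exists 'X; exact: horner_morphX cgX.
  by exists u%:P; exact: etrans (horner_morphC cgX u) Hu.
Qed.

(** Lift the homogeneous elements [g n] in degree [n] to the noetherian ring [N]; some lift is a
    combination of the earlier ones, and its image is read off in degree [M]. *)
Lemma rees_relation (g : nat -> R) : (forall n, ideal_pow I n (g n)) ->
  exists (M : nat) (h : nat -> R), (forall i, ideal_pow I (M - i) (h i)) /\
    g M = \sum_(i < M) h i * g i.
Proof.
move=> gI; have [N [phi [noethN phiR phiX]]] := rees_presentation.
have [u uE] := choice (fun n => phiX n (g n) (gI n)).
have [M /ideal_of_mkseq[r rE]] := noeth_seq noethN u.
exists M, (fun i => (phi (r i))`_(M - i)); split; first by move=> i; exact: phiR.
have := congr1 (fun p : {poly R} => p`_M) (congr1 phi rE).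
rewrite uE rmorph_sum coef_sum coefMXn ltnn subnn coefC eqxx => ->.
apply: eq_bigr => i _; rewrite rmorphM uE mulrA coefMXn coefMC.
by rewrite ltnNge ltnW.
Qed.

End Rees.

(** * Integral and tight closure *)

Section IntegralClosure.
Variables (R : comNzRingType) (I : set R).
Implicit Types (z v : R) (p q : {poly R}).

(** Equations of integral dependence as polynomials, so that they can be multiplied and raised to
    powers. *)
Definition integral_poly k p : Prop :=
  [/\ p \is monic, size p = k.+1 & forall j, ideal_pow I (k - j) p`_j].

Lemma integral_polyM k l p q : integral_poly k p -> integral_poly l q ->
  integral_poly (k + l) (p * q).
Proof.
move=> [pm sp pI] [qm sq qI]; split; first by rewrite monicMl.
  rewrite size_monicM // ?sp ?sq ?addnS //.
  by rewrite -size_poly_eq0 sq.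
move=> j; rewrite coefM; apply: (is_ideal_sum _ (is_ideal_pow _ _)) => i.
have /ideal_pow_le : (k + l - j <= k - i + (l - (j - i)))%N by case: i => i /= ?; lia.
by apply; exact: ideal_powM.
Qed.

Lemma integral_poly_root k p z : integral_poly k p -> (0 < k)%N -> p.[z] = 0 ->
  integral_closure I z.
Proof.
move=> [pm sp pI] k0 pz; exists k, (fun i => p`_(k - i)); split=> //.
  by move=> i /andP[_ ik]; have := pI (k - i)%N; rewrite subKn.
transitivity p.[z] => //; rewrite horner_coef sp big_ord_recr /= addrC; congr (_ + _).
  have := pm; rewrite monicE /lead_coef sp /= => /eqP ->.
  by rewrite mul1r.
rewrite big_add1 /= big_mkord (reindex_inj rev_ord_inj) /=; apply: eq_bigr => i _.
by rewrite subnSK // subKn // ltnW.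
Qed.

Lemma integral_poly_nilpotent k p z e : integral_poly k p -> p.[z] ^+ e = 0 ->
  integral_closure I z.
Proof.
move=> kp pz; suff [l lp] : exists l, integral_poly l (p ^+ e).
  (* The extra factor ['X] makes the degree positive even when [k] or [e] is 0. *)
  have X1 : integral_poly 1 'X.
    split; [exact: monicX|by rewrite size_polyX|].
    move=> [|j] //; rewrite coefX /=; exact: is_ideal0 (is_ideal_pow I 1).
  apply: (integral_poly_root (integral_polyM X1 lp)) => //.
  by rewrite hornerM horner_exp pz mulr0.
elim: e {pz} => [|e [l IHe]]; last first.
  by exists (k + l)%N; rewrite exprS; exact: integral_polyM.
exists 0%N; rewrite expr0; split; [exact: monic1|by rewrite size_poly1|].
by move=> j; rewrite sub0n.
Qed.

Lemma integral_closureMl a z : integral_closure I z -> integral_closure I (a * z).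
Proof.
move=> [k [c [k0 cI E]]]; exists k, (fun i => a ^+ i * c i); split=> //.
  by move=> i ik; apply: is_idealMl; [exact: is_ideal_pow|exact: cI].
transitivity (a ^+ k * (z ^+ k + \sum_(1 <= i < k.+1) c i * z ^+ (k - i))).
  rewrite exprMn mulrDr; congr (_ + _).
  rewrite mulr_sumr; apply: eq_big_nat => i /andP[_ ik].
  have -> : a ^+ k = a ^+ i * a ^+ (k - i) by rewrite -exprD subnKC.
  by rewrite exprMn; ring.
by rewrite E mulr0.
Qed.

Lemma sub_integral_closure : is_ideal I -> I `<=` integral_closure I.
Proof.
move=> iI z Iz; exists 1%N, (fun=> - z); split=> // [i ik|].
  have -> : i = 1%N by lia.
  by rewrite ideal_pow1 //; exact: is_idealN.
by rewrite big_nat1 expr0 expr1 mulr1 subrr.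
Qed.

(** With [k] the degree of the equation, [v ^+ n] is in the power [n - k] of [I]: the equation
    replaces it by terms [a i * v ^+ (n - i)] with [a i] in the [i]-th power. *)
Lemma integral_closure_pow v : integral_closure I v ->
  exists k, forall n, ideal_pow I n (v ^+ (n + k)).
Proof.
move=> [k [a [k0 aI E]]]; exists k.
suff vI n : ideal_pow I (n - k) (v ^+ n) by move=> n; have := vI (n + k)%N; rewrite addnK.
have [j] := ubnP n; elim: j n => // j IHj n nj.
have [kn|nk] := leqP k n; last first.
  by have -> : (n - k = 0)%N by lia.
have -> : v ^+ n = - \sum_(1 <= i < k.+1) a i * v ^+ (n - i).
  rewrite -{1}(subnKC kn) exprD; move/eqP: E; rewrite addr_eq0 => /eqP ->.
  rewrite mulNr mulr_suml; congr (- _); apply: eq_big_nat => i /andP[_ ik].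
  by rewrite -mulrA -exprD; congr (_ * _ ^+ _); lia.
apply: (is_idealN (is_ideal_pow _ _)); rewrite big_nat_cond.
apply: big_ind; first exact: is_ideal0 (is_ideal_pow I (n - k)).
  by move=> *; exact: (is_idealD (is_ideal_pow I (n - k))).
move=> i; rewrite andbT => /andP[i1 ik].
have /ideal_pow_le : (n - k <= i + (n - i - k))%N by lia.
apply; apply: ideal_powM; first by apply: aI; rewrite i1.
by apply: IHj; lia.
Qed.

Lemma integral_closure_criterion c z k : noetherian R -> is_ideal I ->
  (forall P : prime_idealr R, minimal_prime P -> c \notin P) ->
  (forall n, ideal_pow I n (c * z ^+ (n + k))) -> integral_closure I z.
Proof.
move=> noethR iI cP cI; have [M [h [hI hE]]] := rees_relation noethR iI cI.
(* The relation divided by [c]. Its coefficient [h i] sits at exponent [i + k] and lies in the power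
   [M - i = (M + k) - (i + k)] of [I], as integral dependence of degree [M + k] requires. *)
pose q : {poly R} := \sum_(i < M) h i *: 'X^(i + k).
pose p := 'X^(M + k) - q.
have q_size : (size q < (M + k).+1)%N.
  rewrite ltnS; apply: leq_trans (size_sum _ _ _) _; apply/bigmax_leqP => i _.
  apply: leq_trans (size_scale_leq _ _) _; rewrite size_polyXn -addSn leq_add2r.
  exact: ltn_ord.
have kp : integral_poly (M + k) p.
  split.
  - rewrite monicE lead_coefDl ?lead_coefXn // size_polyN size_polyXn //.
  - by rewrite size_polyDl ?size_polyXn // size_polyN.
  - move=> j; rewrite coefB; apply: (is_idealB (is_ideal_pow _ _)).
      rewrite coefXn; case: eqP => [->|_]; first by rewrite subnn.
      by apply: is_ideal0; exact: is_ideal_pow.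
    rewrite coef_sum; apply: (is_ideal_sum _ (is_ideal_pow _ _)) => i.
    rewrite coefZ coefXn; case: eqP => [->|_]; last first.
      by rewrite mulr0; apply: is_ideal0; exact: is_ideal_pow.
    by rewrite subnDr mulr1.
have pz : p.[z] = z ^+ (M + k) - \sum_(i < M) h i * z ^+ (i + k).
  rewrite hornerD hornerN hornerXn horner_sum; congr (_ - _).
  by apply: eq_bigr => i _; rewrite hornerZ hornerXn.
have [e we] : exists e, p.[z] ^+ e = 0.
  apply: nilpotent_of_minimal_primes => // P Pmin.
  have : c * p.[z] \in P.
    rewrite pz mulrBr hE mulr_sumr -sumrB big1 ?rpred0 // => i _.
    by rewrite mulrCA subrr.
  by rewrite prime_idealrM (negPf (cP P Pmin)).
exact: integral_poly_nilpotent kp we.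
Qed.

End IntegralClosure.

Section TightClosure.
Variables (R : comNzRingType) (p : nat).
Implicit Types (I J : set R) (s : seq R).

Lemma tight_closureMl I a z : tight_closure p I z -> tight_closure p I (a * z).
Proof.
move=> [c cP [e0 cI]]; exists c => //; exists e0 => e /cI.
rewrite exprMn mulrCA; apply: is_idealMl; exact: is_ideal_span.
Qed.

Lemma sub_tight_closure I : I `<=` tight_closure p I.
Proof.
move=> z Iz; exists 1; first by move=> P _; rewrite idealr1.
by exists 0%N => e _; rewrite mul1r; apply: ideal_span_gen; exists z.
Qed.

Hypothesis charR : p \in [pchar R].

(** In characteristic [p] the map [u -> u ^+ q] is a ring endomorphism, so preimages of ideals under
    it are ideals and generators suffice. This brings Frobenius powers into the form handled by the
    colon killer. *)
Lemma frobenius_power_pow s n e : frobenius_power (ideal_pow (ideal_of s) n) (p ^ e) =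
  ideal_pow (ideal_of [seq a ^+ (p ^ e) | a <- s]) n.
Proof.
set q := (p ^ e)%N; set sq := map _ s.
have addX (u v : R) : (u + v) ^+ q = u ^+ q + v ^+ q.
  by apply: exprDn_pchar; rewrite /q pnatX pnatE ?(pcharf_prime charR) ?charR.
have q0 : (0 < q)%N by rewrite expn_gt0 (prime_gt0 (pcharf_prime charR)).
have preim I : is_ideal I -> is_ideal [set u : R | I (u ^+ q)].
  move=> iI; split=> [|u v Iu Iv|u v Iv] /=.
  - by rewrite expr0n gtn_eqF //; exact: is_ideal0.
  - by rewrite addX; exact: is_idealD.
  - by rewrite exprMn; exact: is_idealMl.
have iF I : is_ideal (frobenius_power I q) by exact: is_ideal_span.
apply/seteqP; split.
  apply: ideal_span_sub; first exact: is_ideal_pow.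
  move=> _ [u Iu <-].
  suff : ideal_pow (ideal_of s) n `<=` [set u | ideal_pow (ideal_of sq) n (u ^+ q)] by apply.
  elim: n {u Iu} => [|n IHn] //; apply: ideal_mul_sub.
    by apply: preim; exact: is_ideal_pow.
  move=> a b sa Ib; rewrite /= exprMn; apply: ideal_mulM; last exact: IHn.
  suff : ideal_of s `<=` [set u | ideal_of sq (u ^+ q)] by apply.
  apply: ideal_of_sub; first by apply: preim; exact: is_ideal_of.
  by move=> c sc; apply: ideal_of_mem; exact: map_f.
elim: n => [|n IHn].
  move=> u _; rewrite -[u]mulr1 -(expr1n _ q); apply: (is_idealMl _ (iF _)).
  by apply: ideal_span_gen; exists 1.
apply: subset_trans (_ : ideal_mul (ideal_of sq) (frobenius_power (ideal_pow (ideal_of s) n) q) `<=` _).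
  exact: ideal_mulS.
apply: ideal_mul_sub => // a b sa Fb.
suff : ideal_of sq `<=` colon (frobenius_power (ideal_pow (ideal_of s) n.+1) q) b by apply.
apply: ideal_of_sub; first exact/is_ideal_colon/iF.
move=> _ /mapP[c sc ->].
suff : frobenius_power (ideal_pow (ideal_of s) n) q `<=`
    colon (frobenius_power (ideal_pow (ideal_of s) n.+1) q) (c ^+ q).
  by move=> /(_ _ Fb); rewrite /colon /= mulrC.
apply: ideal_span_sub; first exact/is_ideal_colon/iF.
move=> _ [u Iu <-]; rewrite /colon /= -exprMn; apply: ideal_span_gen.
exists (u * c) => //; rewrite mulrC; apply: ideal_mulM => //; exact: ideal_of_mem.
Qed.

End TightClosure.

Lemma contains_field_pchar (R : comNzRingType) p :
  contains_field_of_char R p -> p \in [pchar R].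
Proof. by move=> [K [f [_]]]; exact: rmorph_pchar. Qed.

(** * Chains of primes *)

Section Chains.
Variable R : comNzRingType.
Implicit Types (I P Q : set R) (C : nat -> set R).

Definition is_chain k C : Prop :=
  (forall i, (i <= k)%N -> is_prime (C i)) /\ (forall i, (i < k)%N -> C i `<` C i.+1).

Lemma is_chain_cons k C Q : is_prime Q -> Q `<` C 0%N -> is_chain k C ->
  is_chain k.+1 (fun i => if i is j.+1 then C j else Q).
Proof. by move=> QP QC [Cp Cs]; split=> [[|i] //|[|i] //]; [exact: Cp|exact: Cs]. Qed.

Lemma krull_dim_chain n k C : has_krull_dim R n -> is_chain k C -> (k <= n)%N.
Proof.
move=> [_ max_n] [Cp Cs].
have [P PE] := choice (fun i => prime_idealrP (Cp (minn i k) (geq_minr i k))).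
apply: (max_n k P) => i ik; rewrite !PE; have -> : minn i k = i by lia.
by have -> : minn i.+1 k = i.+1; [lia|exact: Cs].
Qed.

Lemma krull_dim_ex_chain n : has_krull_dim R n -> exists C, is_chain n C.
Proof.
move=> [[P PC] _]; exists (fun i => [set` P i]); split=> // i _.
exact: is_prime_idealr.
Qed.

End Chains.

Section Surjection.
Variables (A B : comNzRingType) (f : {rmorphism A -> B}).

Lemma is_ideal_preim I : is_ideal I -> is_ideal (f @^-1` I).
Proof.
move=> iI; split=> [|a b|a b]; rewrite /preimage /=.
- by rewrite rmorph0; exact: is_ideal0.
- by rewrite rmorphD; exact: is_idealD.
- by rewrite rmorphM; exact: is_idealMl.
Qed.

Lemma is_prime_preim P : is_prime P -> is_prime (f @^-1` P).
Proof.
move=> [iP P1 PM]; split; first exact: is_ideal_preim.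
  by rewrite /preimage /= rmorph1.
by move=> a b; rewrite /preimage /= rmorphM => /PM.
Qed.

Hypothesis f_surj : forall b, exists a, f a = b.

Lemma is_chain_preim k C : is_chain k C -> is_chain k (fun i => f @^-1` C i).
Proof.
move=> [Cp Cs]; split=> i ik; first exact/is_prime_preim/Cp.
have [CC nCC] := Cs i ik; split=> [a|H]; first exact: CC.
by apply: nCC => b; have [a <-] := f_surj b; exact: H.
Qed.

Lemma is_ideal_image I : is_ideal I -> is_ideal (f @` I).
Proof.
move=> iI; split; first by exists 0; [exact: is_ideal0|exact: rmorph0].
  by move=> _ _ [a Ia <-] [b Ib <-]; exists (a + b); [exact: is_idealD|rewrite rmorphD].
move=> b _ [a Ia <-]; have [c <-] := f_surj b.
by exists (c * a); [exact: is_idealMl|rewrite rmorphM].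
Qed.

Definition rker : set A := [set a | f a = 0].

Lemma is_ideal_rker : is_ideal rker.
Proof.
split=> [|a b|a b]; rewrite /rker /= ?rmorph0 ?rmorphD ?rmorphM //.
  by move=> -> ->; rewrite addr0.
by move=> ->; rewrite mulr0.
Qed.

Lemma mem_of_image I a : is_ideal I -> rker `<=` I -> (f @` I) (f a) -> I a.
Proof.
move=> iI kI [b Ib fab]; rewrite -[a](subrK b); apply: is_idealD => //.
by apply: kI; rewrite /rker /= rmorphB fab subrr.
Qed.

Lemma is_prime_image P : is_prime P -> rker `<=` P -> is_prime (f @` P).
Proof.
move=> [iP P1 PM] kP; split; first exact: is_ideal_image.
  by rewrite -(rmorph1 f) => /(mem_of_image iP kP).
move=> b c; have [u <-] := f_surj b; have [v <-] := f_surj c.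
rewrite -rmorphM => /(mem_of_image iP kP)/PM[H|H]; [left; exists u|right; exists v] => //.
Qed.

Lemma is_chain_image k C : is_chain k C -> rker `<=` C 0%N -> is_chain k (fun i => f @` C i).
Proof.
move=> [Cp Cs] kC; have kCi i : (i <= k)%N -> rker `<=` C i.
  elim: i => // i IHi ik; apply: subset_trans (IHi (ltnW ik)) _.
  by case: (Cs i ik).
split=> i ik; first by apply: is_prime_image; [exact: Cp|exact: kCi].
have [CC nCC] := Cs i ik; split=> [_ [a Ca <-]|H]; first by exists a => //; exact: CC.
apply: nCC => a Ca; apply: mem_of_image; [|exact/kCi/ltnW|by apply: H; exists a].
by case: (Cp i (ltnW ik)).
Qed.

End Surjection.

Section LocalRings.
Variable R : comNzRingType.

Lemma local_ring_max (m : idealr R) : noetherian R -> local_ring m ->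
  forall I, is_ideal I -> ~ I 1 -> I `<=` [set` m].
Proof.
move=> noethR [_ m_uniq] I iI I1.
have [||J [[iJ J1] IJ maxJ]] := @noeth_max R noethR [set J | is_ideal J /\ ~ J 1] I.
- by move=> J [].
- by [].
have [Q QE] := idealrP iJ J1; rewrite -(m_uniq Q) ?QE // => K.
rewrite QE => JK; apply: maxJ => //; split; first exact: is_ideal_idealr.
by rewrite /= idealr1.
Qed.

Lemma reg_regular_sequence (t s : seq R) :
  (forall i, (i < size s)%N -> forall a, ideal_of (t ++ take i s) (a * s`_i) ->
     ideal_of (t ++ take i s) a) -> reg (ideal_of t) s.
Proof.
elim: s t => //= a s IHs t tP; split.
  by move=> u; have := tP 0%N isT u; rewrite /= cats0.
have -> : addi (ideal_of t) a = ideal_of (rcons t a).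
  rewrite -ideal_of_cons; apply: ideal_of_eq_mem => b.
  by rewrite mem_rcons.
apply: IHs => i ik b; have := tP i.+1 ik b.
by rewrite /= -cat_rcons.
Qed.

End LocalRings.

(** * Cutting down the Cohen-Macaulay ring by regular elements of [J] *)

Section Reduction.
Variables (A : comNzRingType) (m : set A).
Hypotheses (noethA : noetherian A) (m_ideal : is_ideal m).
Hypotheses (m_max : forall I, is_ideal I -> ~ I 1 -> I `<=` m) (m1 : ~ m 1).

(* Killing elements of [J] that are regular one after the other lowers the depth
   and the dimension together, until [J] consists of zero divisors. *)
Lemma regular_reduction J k I : is_ideal J -> J `<=` m -> is_ideal I -> I `<=` J ->
  depth_ge m I k -> (forall l C, is_chain l C -> I `<=` C 0%N -> (l <= k)%N) ->
  exists Y k', [/\ is_ideal Y, Y `<=` J, depth_ge m Y k',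
    forall l C, is_chain l C -> Y `<=` C 0%N -> (l <= k')%N
    & exists2 Q, assoc Y Q & J `<=` Q].
Proof.
move=> iJ Jm; elim: k I => [|k IHk] I iI IJ dI Ik.
all: have [[Q QP JQ]|nQ] := pselect (exists2 Q, assoc I Q & J `<=` Q);
  first by exists I; eexists; split; eauto.
all: have [|y Jy [Iy _]] := @coset_nzd A noethA I I J 0 iI iI iJ;
  first by move=> Q QP _ JQ; apply: nQ; exists Q => //; case: QP.
all: rewrite add0r in Iy; have my := Jm _ Jy.
  (* For [k = 0] no [y] in [J] is regular modulo [I]: a prime associated to [I] and one above it
     containing [y] would form a chain of length 1. *)
  have [|Q QP _] := assoc_zero_divisor noethA (b := 1) iI; first by move/IJ/Jm/m1.
  have [Q' [Q'P QQ' Q'y]] := assoc_up noethA m_ideal m_max m1 iI my Iy QP.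
  suff /Ik : is_chain 1 (fun i => if i is 0%N then Q else Q').
    by move=> /(_ (assoc_sub iI QP)).
  split=> [[|i] _|[|//] _]; first by case: QP.
    by case: Q'P.
  by split=> // /(_ _ Q'y); exact: nzd_not_assoc QP.
apply: (IHk (addi I y)) => //.
- exact: is_ideal_addi.
- exact: addi_sub.
- exact: depth_ge_addi.
(* A chain over [I + (y)] is lengthened downwards by an associated prime of [I], which cannot
   contain [y]; so the bound on chains drops by one. *)
move=> l C Cl IC; have [Cp Cs] := Cl.
have IC0 : I `<=` C 0%N by apply: subset_trans IC; exact: sub_addi.
have [Q QP QC] := assoc_below noethA iI (Cp 0%N isT) IC0.
have QC0 : Q `<` C 0%N.
  by split=> // CQ; apply: (nzd_not_assoc Iy QP); apply/CQ/IC; exact: addi_gen.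
by have := Ik _ _ (is_chain_cons QP.1 QC0 Cl) (assoc_sub iI QP).
Qed.

End Reduction.

(** * The reduction to regular sequences *)

Section QuotientChain.
Variables (R : comNzRingType) (P : prime_idealr R).

Lemma quotient_chain n : has_krull_dim {ideal_quot P} n ->
  exists C, is_chain n C /\ [set` P] `<=` C 0%N.
Proof.
pose pi : {rmorphism R -> {ideal_quot P}} := \pi_{ideal_quot P}%qT.
have pi_surj b : exists a, pi a = b by exists (repr b); exact: reprK.
move=> /krull_dim_ex_chain[C [Cp Cs]]; exists (fun i => pi @^-1` C i).
split; first exact: is_chain_preim.
move=> a Pa; rewrite /preimage /=; have -> : pi a = 0.
  by rewrite -(rmorph0 pi); apply/eqP; rewrite -Quotient.idealrBE subr0.
by apply: is_ideal0; case: (Cp 0%N isT).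
Qed.

End QuotientChain.

Section Lift.
Variables (A R : comNzRingType) (f : {rmorphism A -> R}) (mA : idealr A) (m : idealr R).
Variable x : seq R.
Hypotheses (A_cm : cohen_macaulay_local mA) (f_surj : forall b, exists a, f a = b).
Hypotheses (R_local : local_ring m) (R_noeth : noetherian R).
Hypotheses (R_equidim : equidimensional R) (x_sop : system_of_parameters m x).

Local Notation J := (rker f).

Let R_dim : has_krull_dim R (size x). Proof. by case: x_sop. Qed.
Let A_noeth : noetherian A. Proof. by case: A_cm. Qed.
Let mA_ideal : is_ideal [set` mA]. Proof. exact: is_ideal_idealr. Qed.
Let mA1 : ~ [set` mA] 1. Proof. by rewrite /= idealr1. Qed.
Let mA_max (I : set A) : is_ideal I -> ~ I 1 -> I `<=` [set` mA].
Proof. by apply: local_ring_max => //; case: A_cm. Qed.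
Let J_ideal : is_ideal J. Proof. exact: is_ideal_rker. Qed.
Let J_sub : J `<=` [set` mA].
Proof.
apply: mA_max => //; rewrite /rker /= rmorph1 => /eqP; apply/negP; exact: oner_neq0.
Qed.

Let mem_maximal a : f a \in m <-> a \in mA.
Proof.
split=> Ha.
  apply: (mA_max (I := f @^-1` [set` m])) => //.
    by apply: is_ideal_preim; exact: is_ideal_idealr.
  by rewrite /preimage /= rmorph1 idealr1.
apply: (local_ring_max R_noeth R_local (I := f @` [set` mA])); last by exists a.
  exact: is_ideal_image.
by rewrite -(rmorph1 f) => /(mem_of_image mA_ideal J_sub).
Qed.

(** The remaining depth [k] is dim [R]: a chain of length [k] starting at the associated prime over
    [J] maps to [R], and a longest chain of [R] pulls back to one over [Y]. *)
Let reduction : exists Y, [/\ is_ideal Y, Y `<=` J, depth_ge [set` mA] Y (size x) &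
  forall l C, is_chain l C -> Y `<=` C 0%N -> (l <= size x)%N].
Proof.
have [_ _ [D A_dim [[s [[s_reg s1] sm] sD] _]]] := A_cm.
have z0 : is_ideal [set (0 : A)] by exact: is_ideal_zero.
have [|||Y [k [iY YJ dY Yk [Q QY JQ]]]] :=
    @regular_reduction A [set` mA] A_noeth mA_ideal mA_max mA1 J D [set 0] J_ideal J_sub z0.
- by move=> _ ->; exact: is_ideal0.
- exists s; split=> //; rewrite -ideal_of_nil; apply: reg_regular_sequence => i ik a.
  exact: s_reg.
- by move=> l C Cl _; exact: krull_dim_chain A_dim Cl.
suff E : k = size x by exists Y; rewrite -E.
apply/eqP; rewrite eqn_leq; apply/andP; split.
  have [C [C0 Cp Cs]] := depth_ge_chain A_noeth mA_ideal mA_max mA1 iY dY QY.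
  apply: (krull_dim_chain R_dim (C := fun i => f @` C i)).
  by apply: is_chain_image => //; rewrite C0.
have [C CC] := krull_dim_ex_chain R_dim.
apply: (Yk _ _ (is_chain_preim f_surj CC)) => y /YJ Jy.
rewrite /preimage /= [f y]Jy; apply: is_ideal0; by case: (CC.1 0%N isT).
Qed.

Let minimal_prime_chain (P : prime_idealr R) : minimal_prime P ->
  exists C, is_chain (size x) C /\ f @^-1` [set` P] `<=` C 0%N.
Proof.
move=> Pmin; have [C [CC PC]] := quotient_chain ((R_equidim Pmin _).2 R_dim).
exists (fun i => f @^-1` C i); split; first exact: is_chain_preim.
by move=> a; exact: PC.
Qed.

Let primary_lift (xs : seq A) : [seq f a | a <- xs] = x -> primary_mod [set` mA] J xs.
Proof.
move=> fxs u /mem_maximal fu.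
have [e He] : radical (ideal_of x) (f u) by rewrite x_sop.2.
exists e; set K := foldl _ _ _.
have [iK JK xK] : [/\ is_ideal K, J `<=` K & forall a, a \in xs -> K a].
  rewrite {}/K; elim: xs (J) (J_ideal) {fxs} => [|a xs IHs] I iI; first by split.
  have [iK IK xK] := IHs _ (is_ideal_addi a iI); split=> //.
    by apply: subset_trans IK; exact: sub_addi.
  by move=> b; rewrite in_cons => /predU1P[->|/xK//]; apply: IK; exact: addi_gen.
apply: (mem_of_image iK JK); rewrite rmorphXn; apply: ideal_of_sub He.
  exact: is_ideal_image.
by rewrite -fxs => _ /mapP[a xa ->]; exists a => //; exact: xK.
Qed.

(** Equidimensionality gives a chain of length [size x] above the preimage of each minimal prime. A
    smaller prime over [Y] would extend it beyond the bound for [Y], so the preimage is minimal over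
    [Y], hence associated. *)
Lemma parameter_lift : exists Y (y : seq A), [/\ is_ideal Y, Y `<=` J,
  map f y = x, (forall a, a \in y -> a \in mA) /\ reg Y y &
  forall P : prime_idealr R, minimal_prime P -> assoc Y (f @^-1` [set` P]) /\
    forall Q, is_prime Q -> Y `<=` Q -> Q `<=` f @^-1` [set` P] -> Q = f @^-1` [set` P]].
Proof.
have [Y [iY YJ dY Yx]] := reduction.
have [g gK] := choice f_surj.
have fgx : map f (map g x) = x by rewrite -map_comp -[RHS]map_id; apply: eq_map.
have memA a : f a \in x -> a \in mA.
  move=> xa; apply/mem_maximal.
  have : radical (ideal_of x) (f a) by exists 1%N; rewrite expr1; exact: ideal_of_mem.
  by rewrite x_sop.2.
have [|||y [ysz Jy regy]] :=
    @regular_lift A [set` mA] A_noeth mA_ideal mA_max mA1 J Y (map g x) J_ideal J_sub iY.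
- by rewrite size_map.
- by move=> _ /mapP[b xb ->]; apply: memA; rewrite gK.
- by move=> Q _ JQ _; apply: primary_mod_sub (primary_lift fgx).
rewrite size_map in ysz.
have fy : map f y = x.
  apply: (@eq_from_nth _ 0); rewrite size_map // => i iy.
  rewrite (nth_map 0) //; have : f (y`_i - (map g x)`_i) = 0 by exact: Jy.
  by rewrite rmorphB (nth_map 0) -?ysz // gK => /subr0_eq.
exists Y, y; split=> //.
  by split=> // a ya; apply: memA; rewrite -fy; exact: map_f.
move=> P Pmin; have [C [CC PC]] := minimal_prime_chain Pmin.
have PP : is_prime (f @^-1` [set` P]) by apply: is_prime_preim; exact: is_prime_idealr.
have YP : Y `<=` f @^-1` [set` P].
  by move=> a /YJ fa; rewrite /preimage /= [f a]fa; exact: idealr0.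
have Pmin' Q : is_prime Q -> Y `<=` Q -> Q `<=` f @^-1` [set` P] -> Q = f @^-1` [set` P].
  move=> QP YQ QsubP; apply/seteqP; split=> //; apply: contrapT => nPQ.
  have QC : Q `<` C 0%N.
    split; first exact: subset_trans PC.
    by move=> CQ; apply: nPQ; exact: subset_trans CQ.
  by have := Yx _ _ (is_chain_cons QP QC CC) YQ; rewrite ltnn.
split=> //; have [Q QY QsubP] := assoc_below A_noeth iY PP YP.
by rewrite -(Pmin' Q) //; [case: QY|exact: assoc_sub].
Qed.

(** [colon_killer] treats one minimal prime at a time. The elements that work for all sequences form
    an ideal [D], and prime avoidance finds one of them outside all the preimages of minimal
    primes. *)
Lemma uniform_colon_killer s : (s < size x)%N ->
  exists2 c, (forall P : prime_idealr R, minimal_prime P -> c \notin P) &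
    forall q r n w, (0 < q)%N ->
      let I := ideal_pow (ideal_of [seq a ^+ q | a <- take s x]) n in
      I (w * (x`_s ^+ q) ^+ r) -> I (c * w).
Proof.
move=> sx; have [Y [y [iY YJ fy [my regy] PY]]] := parameter_lift.
have ysz : size y = size x by rewrite -fy size_map.
pose D := [set c | forall t X, size t = s -> nzd_filt Y (X :: t) -> forall n w,
   sum_ideal (filt Y t n) J (w * X) -> sum_ideal (filt Y t n) J (c * w)].
have iS t n : is_ideal (sum_ideal (filt Y t n) J).
  have [iG _ _ _] := filtration_filt t iY; have iGn := iG n.
  split=> [|_ _ [a [b [Ha Hb ->]]] [a' [b' [Ha' Hb' ->]]]|c _ [a [b [Ha Hb ->]]]].
  - by exists 0, 0; split; [exact: is_ideal0|exact: is_ideal0|rewrite addr0].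
  - by exists (a + a'), (b + b'); split; [exact: is_idealD|exact: (is_idealD J_ideal)|ring].
  - by exists (c * a), (c * b); split; [exact: is_idealMl|exact: (is_idealMl _ J_ideal)|ring].
have iD : is_ideal D.
  split=> [|b c Db Dc|b c Dc] t X szt tX n w H.
  - by rewrite mul0r; exact: is_ideal0.
  - by rewrite mulrDl; apply: (is_idealD (iS t n)); [exact: Db H|exact: Dc H].
  - by rewrite -mulrA; apply: (is_idealMl _ (iS t n)); exact: Dc H.
have [Qs QsP] := assoc_finite A_noeth iY.
pose Qs' := [seq Q <- Qs | `[< exists2 P : prime_idealr R, minimal_prime P &
  Q = f @^-1` [set` P] >]].
have [||c Dc cQ] := @prime_avoidance A Qs' D iD.
- by move=> Q; rewrite mem_filter => /andP[_ /QsP[]].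
- move=> Q; rewrite mem_filter => /andP[/asboolP[P /PY[YP Pmin] ->] _] DP.
  have [c nc cP] := @colon_killer A A_noeth Y _ iY YP Pmin s J J_ideal YJ.
  by apply/nc/DP.
exists (f c) => [P Pmin|q r n w q0 I].
  apply/negP => fcP; apply: (cQ (f @^-1` [set` P])) => //.
  rewrite mem_filter; apply/andP; split; first by apply/asboolP; exists P.
  by apply/QsP; case: (PY P Pmin).
have [v <-] := f_surj w.
have fYJ b : Y b -> f b = 0 by exact: YJ.
pose t := [seq a ^+ q | a <- take s y].
have IE : I = f @` filt Y t n.
  have fT : range f = [set: R].
    by apply/seteqP; split=> // b _; have [a <-] := f_surj b; exists a.
  rewrite (image_filt _ _ fT iY fYJ) /I /t -fy -map_take -!map_comp.
  by congr (ideal_pow (ideal_of _) n); apply: eq_map => a /=; rewrite rmorphXn.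
have sumE u : sum_ideal (filt Y t n) J u -> I (f u).
  move=> [g [j [Hg Hj ->]]]; rewrite rmorphD [f j]Hj addr0 IE.
  by exists g.
have xs : x`_s = f y`_s by rewrite -fy (nth_map 0) // ysz.
rewrite xs -!rmorphXn -!rmorphM => Iv; apply: sumE.
apply: (Dc t ((y`_s ^+ q) ^+ r)).
- by rewrite size_map size_takel // ysz ltnW.
(* The powers [q] and [r] cost nothing: [q]-th powers of a regular sequence are regular, and a power
   of a nonzerodivisor is one. *)
- have mt a : a \in take s.+1 y -> a \in mA by move/mem_take; exact: my.
  have regt : reg Y (map (fun a => a ^+ q) (take s.+1 y)).
    apply: (@reg_map_exp A [set` mA]) => //.
    by apply: (@reg_catl _ _ _ (drop s.+1 y)); rewrite cat_take_drop.
  have mq a : a \in map (fun a => a ^+ q) (take s.+1 y) -> a \in mA.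
    by move=> /mapP[b /mt mb ->]; apply: (is_idealX mA_ideal).
  move: regt mq; rewrite (take_nth 0) ?ysz // map_rcons -/t => regt mq.
  have regt' : reg Y (y`_s ^+ q :: t).
    apply: (@reg_perm A [set` mA]) regt => //; by rewrite perm_rcons.
  have [|tn Xn] := @reg_nzd_filt A [set` mA] A_noeth mA_ideal mA_max mA1 Y _ iY _ regt'.
    by move=> a; rewrite -mem_rcons; exact: mq.
  by split=> // k; exact: nzdX.
move: Iv; rewrite IE => -[g Hg fg].
exists g, (v * y`_s ^+ q ^+ r - g); split=> //; last by rewrite addrC subrK.
by rewrite /rker /= rmorphB fg subrr.
Qed.

End Lift.

(** * Both closures from the uniform colon killer *)

Theorem corollary1p2 (R : comNzRingType) (m : idealr R) (d : nat)
    (x : d.-tuple R) (R_local : local_ring m) (R_noeth : noetherian R)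
    (R_dim : has_krull_dim R d) (R_equidim : equidimensional R)
    (R_image : image_of_cohen_macaulay_local R)
    (x_sop : system_of_parameters m x) (s n : nat) (s_lt_d : (s < d)%N)
    (n_ge1 : (1 <= n)%N) :
  let I := ideal_pow (ideal_of (take s x)) n in
  (colon I x`_s `<=` colon (integral_closure I) x`_s /\
   colon (integral_closure I) x`_s = integral_closure I) /\
  (forall p : nat, contains_field_of_char R p ->
   colon I x`_s `<=` colon (tight_closure p I) x`_s /\
   colon (tight_closure p I) x`_s = tight_closure p I).
Proof.
move=> I; have [A [mA [f [A_cm f_range]]]] := R_image.
have f_surj b : exists a, f a = b.
  have [a _ <-] : range f b by rewrite f_range.
  by exists a.
have iI : is_ideal I by exact: is_ideal_pow.
have sx : (s < size x)%N by rewrite size_tuple.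
have [c cP cI] := uniform_colon_killer A_cm f_surj R_local R_noeth R_equidim x_sop sx.
(* Puts powers of [I] in the form required by the killer, with [q = 1]. *)
have IE k : ideal_pow I k = ideal_pow (ideal_of [seq a ^+ 1 | a <- take s x]) (n * k).
  by rewrite ideal_pow_pow; congr (ideal_pow (ideal_of _) _); rewrite map_id_in.
split=> [|p /contains_field_pchar charR]; split.
- by move=> a; exact: (sub_integral_closure iI).
- apply/seteqP; split=> z; last by rewrite /colon /= mulrC; exact: integral_closureMl.
  move=> /integral_closure_pow[k zk].
  apply: (integral_closure_criterion R_noeth iI cP (k := k)) => j.
  (* From [(z x)^(j + k)] in the [j]-th power of [I], the killer with [r = j + k] strips off the
     power of [x]. *)
  rewrite IE; apply: (cI 1%N (j + k)%N) => //; rewrite -IE expr1 -exprMn.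
  exact: zk.
- by move=> a; exact: (@sub_tight_closure R p I).
apply/seteqP; split=> z; last by rewrite /colon /= mulrC; exact: tight_closureMl.
(* For [q = p ^ e] and [r = 1] the killer removes [x ^+ q] from [c0 * z ^+ q * x ^+ q]; [c] is the
   same for all [e], so [c * c0] is a valid multiplier for [z]. *)
move=> [c0 c0P [e0 c0I]]; exists (c * c0).
  by move=> P Pmin; rewrite prime_idealrM negb_or cP // c0P.
exists e0 => e /c0I; rewrite frobenius_power_pow // exprMn mulrA => H.
rewrite -mulrA; apply: (cI _ 1%N) => //.
by rewrite expn_gt0 (prime_gt0 (pcharf_prime charR)).
Qed.
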